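(* Consider a 3-user CGZIC $Y_1=X_1+Z_1$, $Y_2=X_2+a_1X_1+Z_2$, $Y_3=X_3+a_2X_2+Z_3$ with gains $a_1,a_2\ge 0$ and power constraints $P_1,P_2,P_3$, and suppose $a_1<1$ and $\sqrt{\frac{1+P_3}{1+a_1^2P_1}}\le a_2<\sqrt{1+P_3}$. Then the sum capacity is \[ C_{\mathrm{sum}}=\mathcal{C}(P_1)+\mathcal{C}\!\left(\frac{P_2}{1+a_1^2P_1}\right)+\mathcal{C}(P_3). \]
   Context: The noises $Z_i\sim\mathcal N(0,1)$ are i.i.d. (independent across users and time), the channel is memoryless and real, user $i$ has average power constraint $P_i>0$, each receiver $i$ decodes only its own message from $Y_i^n$, and achievability is defined in the standard way. The sum capacity is the supremum of $R_1+R_2+R_3$ over the capacity region. $\mathcal{C}(x)=\tfrac12\log_2(1+x)$. *)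

(* Defs.v *)
From HB Require Import structures.
From mathcomp Require Import all_boot all_order all_algebra.
From mathcomp Require Import all_classical all_reals all_analysis.
Set Implicit Arguments. Unset Strict Implicit. Unset Printing Implicit Defensive.
Import Order.TTheory GRing.Theory Num.Def Num.Theory.
Local Open Scope classical_set_scope.
Local Open Scope ring_scope.

Section CGZIC.
Variable R : realType.

Definition log2 (x : R) : R := ln x / ln 2.
Definition Cfun (x : R) : R := 2^-1 * log2 (1 + x).

Definition tadd n (x y : n.-tuple R) : n.-tuple R :=
  [tuple tnth x i + tnth y i | i < n].
Definition tscale n (a : R) (x : n.-tuple R) : n.-tuple R :=
  [tuple a * tnth x i | i < n].

(* Expectation w.r.t. n i.i.d. N(0,1) coordinates, as an iterated integral
   (equal to the integral against the n-fold product Gaussian measure for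
   measurable nonnegative integrands, by Tonelli). *)
Fixpoint gauss_int (n : nat) : (n.-tuple R -> \bar R) -> \bar R :=
  match n return (n.-tuple R -> \bar R) -> \bar R with
  | 0 => fun f => f [tuple]
  | m.+1 => fun f =>
      (\int[normal_prob (0:R) 1]_x gauss_int (fun t : m.-tuple R => f (cons_tuple x t)))%E
  end.

Record code (n M1 M2 M3 : nat) := Code {
  enc1 : 'I_M1 -> n.-tuple R;
  enc2 : 'I_M2 -> n.-tuple R;
  enc3 : 'I_M3 -> n.-tuple R;
  dec1 : n.-tuple R -> 'I_M1;
  dec2 : n.-tuple R -> 'I_M2;
  dec3 : n.-tuple R -> 'I_M3 }.

Definition power_ok n (P : R) (x : n.-tuple R) : Prop :=
  \sum_(t < n) (tnth x t) ^+ 2 <= n%:R * P.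

Definition admissible n M1 M2 M3 (P1 P2 P3 : R) (c : code n M1 M2 M3) : Prop :=
  [/\ forall w, power_ok P1 (enc1 c w),
      forall w, power_ok P2 (enc2 c w)
    & forall w, power_ok P3 (enc3 c w)] /\
  [/\ forall m, measurable (dec1 c @^-1` [set m]),
      forall m, measurable (dec2 c @^-1` [set m])
    & forall m, measurable (dec3 c @^-1` [set m])].

Definition err_event n M1 M2 M3 (a1 a2 : R) (c : code n M1 M2 M3)
  (w1 : 'I_M1) (w2 : 'I_M2) (w3 : 'I_M3) (z1 z2 z3 : n.-tuple R) : bool :=
  [|| dec1 c (tadd (enc1 c w1) z1) != w1,
      dec2 c (tadd (tadd (enc2 c w2) (tscale a1 (enc1 c w1))) z2) != w2
    | dec3 c (tadd (tadd (enc3 c w3) (tscale a2 (enc2 c w2))) z3) != w3].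

Definition perr_msg n M1 M2 M3 (a1 a2 : R) (c : code n M1 M2 M3)
  (w1 : 'I_M1) (w2 : 'I_M2) (w3 : 'I_M3) : \bar R :=
  gauss_int (fun z1 => gauss_int (fun z2 => gauss_int (fun z3 =>
    ((err_event a1 a2 c w1 w2 w3 z1 z2 z3)%:R : R)%:E))).

Definition perr n M1 M2 M3 (a1 a2 : R) (c : code n M1 M2 M3) : \bar R :=
  (((M1 * M2 * M3)%:R : R)^-1%:E *
   \sum_(w1 < M1) \sum_(w2 < M2) \sum_(w3 < M3) perr_msg a1 a2 c w1 w2 w3)%E.

Definition achievable (a1 a2 P1 P2 P3 r1 r2 r3 : R) : Prop :=
  [/\ 0 <= r1, 0 <= r2, 0 <= r3 &
  exists (M1 M2 M3 : nat -> nat) (c : forall n, code n (M1 n) (M2 n) (M3 n)),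
    [/\ forall n, admissible P1 P2 P3 (c n),
        forall n, [/\ 2 `^ (n%:R * r1) <= (M1 n)%:R,
                      2 `^ (n%:R * r2) <= (M2 n)%:R &
                      2 `^ (n%:R * r3) <= (M3 n)%:R]
      & forall e : R, 0 < e -> exists N, forall n, (N <= n)%N ->
          (perr a1 a2 (c n) <= e%:E)%E]].

Definition is_sum_capacity (a1 a2 P1 P2 P3 Csum : R) : Prop :=
  (forall r1 r2 r3, achievable a1 a2 P1 P2 P3 r1 r2 r3 -> r1 + r2 + r3 <= Csum)
  /\ (forall e : R, 0 < e -> exists r1 r2 r3,
        achievable a1 a2 P1 P2 P3 r1 r2 r3 /\ Csum - e < r1 + r2 + r3).

End CGZIC.

(* Main.v *)
(** Converse.  Receiver 3 is given X2 for free, so R3 <= C(P3).  For R1 + R2 only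
    the Z-channel formed by users 1 and 2 matters.  As a1 < 1, one may couple
    Z2 = a1 Z1 + b Z' with a1^2 + b^2 = 1, so that Y2 = X2 + a1 Y1 + b Z'.  Let q be
    the law under which Y2 is Gaussian of the largest allowed variance, W2 is
    (almost) the decoded message dec2(Y2), Y1 given S = Y2 - X2 is drawn from its
    posterior when Y1 ~ N(0, 1 + P1), and W1 is (almost) dec1(Y1).  Nonnegativity of
    the relative entropy of the true law with respect to q is exactly
    (1 - pe1) ln M1 + (1 - pe2) ln M2 <= n C + 2 ln 2: the log-likelihood ratio is a
    quadratic form, whose mean only involves the second moments of the codewords.
    Here Fano's inequality, the worst additive noise lemma and the maximal entropy
    of Gaussians are all contained in a single use of ln T <= T - 1.

    Achievability.  Codewords are chosen greedily (Feinstein): a Gaussian word is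
    good on average, where "good" means small error probability against the
    previously chosen words, power below the constraint, and a small value of an
    arbitrary side cost.  User 2's code is built first, for an AWGN channel of noise
    variance 1 + a1^2 P1; by the hypothesis on a2 both receiver 2 and receiver 3 see
    a less noisy Gaussian channel and can decode it after adding a fixed artificial
    noise vector.  The codes of users 1 and 3 are then built with the side cost "X2
    is decoded wrongly in presence of this word as interference"; receiver 3 decodes
    X2, subtracts it and decodes X3. *)
Require Import Defs.
From HB Require Import structures.
From mathcomp Require Import all_boot all_order all_algebra.
From mathcomp Require Import all_classical all_reals all_analysis.
From mathcomp Require Import measurable_realfun.
From mathcomp Require Import ring lra.
Import Order.TTheory GRing.Theory Num.Def Num.Theory.
Import numFieldNormedType.Exports.
Set Implicit Arguments. Unset Strict Implicit. Unset Printing Implicit Defensive.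
Local Open Scope classical_set_scope.
Local Open Scope ring_scope.

Ltac tup := apply: eq_from_tnth => ?; rewrite !tnth_mktuple.

(** * Vectors, squared norms and Gaussian likelihood ratios *)

Section vectors.
Variable R : realType.

(* Likelihood ratio at [x + z] of N(0, s^2) against the law N(x, 1) of [x + z], with [z ~ N(0, 1)]. *)
Definition lratio1 (s x z : R) : R := s^-1 * expR (z ^+ 2 / 2 - (x + z) ^+ 2 / (2 * s ^+ 2)).

Lemma measurable_lratio1 s x : measurable_fun setT (lratio1 s x).
Proof.
apply: measurable_funM => //; apply: measurableT_comp => //.
apply: measurable_funB; apply: measurable_funM => //; apply: measurable_funX => //.
exact: measurable_funD.
Qed.

Lemma lratio1_ge0 s x z : 0 < s -> 0 <= lratio1 s x z.
Proof. by move=> s0; rewrite mulr_ge0 ?expR_ge0 // invr_ge0 ltW. Qed.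

Lemma measurable_cons_tuple d (T : measurableType d) n (f : T -> R) (g : T -> n.-tuple R) :
  measurable_fun setT f -> measurable_fun setT g ->
  measurable_fun setT (fun x => cons_tuple (f x) (g x)).
Proof. by move=> mf mg; exact: (measurable_cons mf mg). Qed.

Lemma measurable_tuple_fun d (T : measurableType d) n (F : 'I_n -> T -> R) :
  (forall i, measurable_fun setT (F i)) ->
  measurable_fun setT (fun x => [tuple F i x | i < n]).
Proof.
move=> mF; apply/measurable_fun_tnthP => i; apply: (eq_measurable_fun (F i)) => //.
by move=> x _ /=; rewrite tnth_mktuple.
Qed.

Lemma measurable_tadd d (T : measurableType d) n (f g : T -> n.-tuple R) :
  measurable_fun setT f -> measurable_fun setT g ->
  measurable_fun setT (fun x => tadd (f x) (g x)).
Proof.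
move=> mf mg; apply: measurable_tuple_fun => i; apply: measurable_funD.
- exact: (measurableT_comp (measurable_tnth i)).
- exact: (measurableT_comp (measurable_tnth i)).
Qed.

Lemma measurable_tscale d (T : measurableType d) n (a : R) (f : T -> n.-tuple R) :
  measurable_fun setT f -> measurable_fun setT (fun x => tscale a (f x)).
Proof.
move=> mf; apply: measurable_tuple_fun => i; apply: measurable_funM => //.
exact: (measurableT_comp (measurable_tnth i)).
Qed.

Definition sqnorm n (x : n.-tuple R) : R := \sum_(t < n) tnth x t ^+ 2.

Lemma measurable_sqnorm d (T : measurableType d) n (f : T -> n.-tuple R) :
  measurable_fun setT f -> measurable_fun setT (fun x => sqnorm (f x)).
Proof.
move=> mf; apply: measurable_sum => i; apply: measurable_funX.
exact: (measurableT_comp (measurable_tnth i)).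
Qed.

Lemma sqnorm_ge0 n (x : n.-tuple R) : 0 <= sqnorm x.
Proof. by apply: sumr_ge0 => i _; exact: sqr_ge0. Qed.

(** The n-dimensional counterpart of [lratio1]: the density of N(0, s^2 I) over that of N(x, I),
    both taken at [x + z]. *)
Definition lratio n (s : R) (x z : n.-tuple R) : R :=
  (s ^+ n)^-1 * expR (sqnorm z / 2 - sqnorm (tadd x z) / (2 * s ^+ 2)).

Lemma lratio_gt0 n s (x z : n.-tuple R) : 0 < s -> 0 < lratio s x z.
Proof. by move=> s0; rewrite mulr_gt0 ?expR_gt0 // invr_gt0 exprn_gt0. Qed.

Lemma measurable_lratio d (T : measurableType d) n (s : R) (f g : T -> n.-tuple R) :
  measurable_fun setT f -> measurable_fun setT g ->
  measurable_fun setT (fun x => lratio s (f x) (g x)).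
Proof.
move=> mf mg; apply: measurable_funM => //; apply: measurableT_comp => //.
apply: measurable_funB; apply: measurable_funM => //; first exact: measurable_sqnorm.
by apply: measurable_sqnorm; exact: measurable_tadd.
Qed.

Lemma sqnorm_cons n (a : R) (x : n.-tuple R) : sqnorm (cons_tuple a x) = a ^+ 2 + sqnorm x.
Proof.
rewrite /sqnorm big_ord_recl; congr (_ + _).
by apply: eq_bigr => i _; rewrite tnthS; congr (tnth _ _ ^+ 2).
Qed.

Lemma tadd_cons n (a b : R) (x y : n.-tuple R) :
  tadd (cons_tuple a x) (cons_tuple b y) = cons_tuple (a + b) (tadd x y).
Proof.
apply: eq_from_tnth => i; rewrite tnth_mktuple.
by case: (unliftP ord0 i) => [j ->|->]; rewrite ?(tnthS, tnth0) // tnth_mktuple.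
Qed.

Lemma tscale_cons n (a b : R) (x : n.-tuple R) :
  tscale a (cons_tuple b x) = cons_tuple (a * b) (tscale a x).
Proof.
apply: eq_from_tnth => i; rewrite tnth_mktuple.
by case: (unliftP ord0 i) => [j ->|->]; rewrite ?(tnthS, tnth0) // tnth_mktuple.
Qed.

Lemma lratio_cons n s (a b : R) (x z : n.-tuple R) : s != 0 ->
  lratio s (cons_tuple a x) (cons_tuple b z) = lratio1 s a b * lratio s x z.
Proof.
move=> s0; rewrite /lratio /lratio1 tadd_cons !sqnorm_cons mulrACA -expRD exprS invfM.
by congr (_ * expR _); field.
Qed.

Lemma sqnorm_scale n (c : R) (x : n.-tuple R) : sqnorm (tscale c x) = c ^+ 2 * sqnorm x.
Proof. by rewrite /sqnorm mulr_sumr; apply: eq_bigr => i _; rewrite tnth_mktuple exprMn. Qed.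

Lemma ln_lratio n (s : R) (x z : n.-tuple R) : 0 < s ->
  ln (lratio s x z) = - (n%:R * ln s) + sqnorm z / 2 - sqnorm (tadd x z) / (2 * s ^+ 2).
Proof.
move=> s0; rewrite /lratio lnM ?posrE ?expR_gt0 ?invr_gt0 ?exprn_gt0 // expRK.
by rewrite lnV ?posrE ?exprn_gt0 // lnXn // -[ln s *+ n]mulr_natl addrA.
Qed.

Lemma tadd_assoc n (x y z : n.-tuple R) : tadd x (tadd y z) = tadd (tadd x y) z.
Proof. by tup; rewrite addrA. Qed.

Lemma tscale1 n (x : n.-tuple R) : tscale 1 x = x.
Proof. by tup; rewrite mul1r. Qed.

Lemma tadd_subK n (x z : n.-tuple R) : tadd (tadd x z) (tscale (-1) x) = z.
Proof. by tup; ring. Qed.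

Lemma measurable_tscale_id n (c : R) : measurable_fun setT (@tscale R n c).
Proof. by apply: (@measurable_tscale _ _ n c id); exact: measurable_id. Qed.

Lemma measurable_tadd_id n (x : n.-tuple R) : measurable_fun setT (tadd x).
Proof.
by apply: (@measurable_tadd _ _ n (cst x) id); [exact: measurable_cst | exact: measurable_id].
Qed.

Lemma measurable_sqnorm_id n : measurable_fun setT (@sqnorm n).
Proof. by apply: (@measurable_sqnorm _ _ n id); exact: measurable_id. Qed.

End vectors.

(** * Integrals against probability measures; nonnegativity and measurability tactics *)

Lemma prob_integral_cst d (T : measurableType d) (R : realType)
  (P : probability T R) (c : \bar R) : (\int[P]_x c = c)%E.
Proof. by rewrite integral_cst // [X in (_ * X)%E]probability_setT mule1. Qed.

Lemma measurable_integral d1 d2 (T : measurableType d1) (U : measurableType d2)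
  (R : realType) (P : {sigma_finite_measure set U -> \bar R}) (F : T -> U -> \bar R) :
  measurable_fun setT (fun p : T * U => F p.1 p.2) -> (forall x y, 0 <= F x y)%E ->
  measurable_fun setT (fun x => \int[P]_y F x y)%E.
Proof.
move=> mF F0.
exact: (@measurable_fun_fubini_tonelli_F _ _ T U R P (fun p => F p.1 p.2) mF (fun p => F0 p.1 p.2)).
Qed.

Ltac pos := repeat first
  [ done | assumption | apply: ltW; assumption | exact: expR_ge0 | exact: sqr_ge0
  | match goal with
    | |- is_true (0 <= (_ * _)%R)%R => apply: mulr_ge0
    | |- is_true (0 <= (_ + _)%R)%R => apply: addr_ge0
    | |- is_true (0 <= (_^-1)%R)%R => rewrite invr_ge0
    | |- is_true (0 <= (_ ^+ _)%R)%R => apply: exprn_ge0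
    | |- is_true (0 <= lratio1 _ _ _)%R => apply: lratio1_ge0
    | |- is_true (0 <= lratio _ _ _)%R => apply: ltW; apply: lratio_gt0
    | |- is_true (0 <= sqnorm _)%R => apply: sqnorm_ge0
    | |- is_true (@Order.le _ _ _ (EFin _)) => rewrite lee_fin
    | |- is_true (@Order.le _ _ _ (mule _ _)) => apply: mule_ge0
    | |- is_true (@Order.le _ _ _ (@GRing.add _ _ _)) => apply: adde_ge0
    | |- is_true (@Order.le _ _ _ (integral _ _ _)) => apply: integral_ge0 => ? _
    | H : (forall x, is_true (@Order.le _ _ _ (?f x))) |- is_true (@Order.le _ _ _ (?f _)) => exact: H
    end ].

(** Measurability is reduced along the syntax of the integrand. Under an integral sign, Tonelli
    reduces it to joint measurability and nonnegativity. *)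
Ltac meas := repeat first
  [ assumption
  | match goal with
    | |- measurable_fun _ (fun x => (@?a x)%:E) => apply/measurable_EFinP; change (measurable_fun setT a)
    | |- measurable_fun _ (fun x => (@?a x - @?b x)%R) => apply: (@measurable_funB _ _ _ _ a b)
    | |- measurable_fun _ (fun x => (@?a x + @?b x)%R) => apply: (@measurable_funD _ _ _ _ a b)
    | |- measurable_fun _ (fun x => (- @?a x)%R) => apply: (@measurable_funN _ _ _ _ a)
    | |- measurable_fun _ (fun x => (@?a x * @?b x)%R) => apply: (@measurable_funM _ _ _ _ a b)
    | |- measurable_fun _ (fun x => mule (@?a x) (@?b x)) => apply: (@emeasurable_funM _ _ _ _ a b)
    | |- measurable_fun _ (fun x => GRing.add (@?a x) (@?b x)) => apply: (@emeasurable_funD _ _ _ _ a b)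
    | |- measurable_fun _ (fun x => (@?a x) ^+ ?n)%R => apply: (@measurable_funX _ _ _ _ a n)
    | |- measurable_fun _ (fun x => expR (@?a x)) => refine (measurableT_comp (f := expR) (g := a) (@measurable_expR _) _)
    | |- measurable_fun _ (fun x => (@?a x, @?b x)) => refine (measurable_fun_pair (f := a) (g := b) _ _)
    | |- measurable_fun _ (fun x => fst (@?a x)) => refine (measurableT_comp (f := fst) (g := a) measurable_fst _)
    | |- measurable_fun _ (fun x => snd (@?a x)) => refine (measurableT_comp (f := snd) (g := a) measurable_snd _)
    | |- measurable_fun _ (fun x => tadd (@?a x) (@?b x)) => apply: (@measurable_tadd _ _ _ _ a b)
    | |- measurable_fun _ (fun x => tscale ?c (@?a x)) => apply: (@measurable_tscale _ _ _ _ c a)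
    | |- measurable_fun _ (fun x => cons_tuple (@?a x) (@?b x)) => apply: (@measurable_cons_tuple _ _ _ _ a b)
    | |- measurable_fun _ (fun x => sqnorm (@?a x)) => apply: (@measurable_sqnorm _ _ _ _ a)
    | |- measurable_fun _ (fun x => lratio ?s (@?a x) (@?b x)) => apply: (@measurable_lratio _ _ _ _ s a b)
    | |- measurable_fun _ (fun x => integral _ setT (@?F x)) =>
        apply: (@measurable_integral _ _ _ _ _ _ F); [cbv beta | by intros; cbv beta; pos]
    | |- measurable_fun _ (fun x => ?f (@?a x)) =>
        match goal with H : measurable_fun _ f |- _ => refine (measurableT_comp (f := f) (g := a) H _) end
    end
  | exact: measurable_cst | exact: measurable_id | exact: measurable_fst | exact: measurable_snd
  | match goal with
    | |- measurable_fun _ (tscale _) => exact: measurable_tscale_id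
    | |- measurable_fun _ (tadd _) => exact: measurable_tadd_id
    | |- measurable_fun _ (@sqnorm _ _) => exact: measurable_sqnorm_id
    end ].

(* Skips equations and other main goals: closing attempts on them unfold the integrals. *)
Ltac side := lazymatch goal with
  | |- @eq _ _ _ => fail
  | |- is_true (@Order.le _ _ (@GRing.zero _) _) => solve [pos]
  | |- is_true _ => fail
  | |- measurable_fun _ _ => solve [meas]
  | |- measurable _ => done
  | |- forall x, is_true _ => intro; cbv beta; side
  | |- forall x, _ => intro; side
  end.

(** * One-dimensional Gaussian integrals *)

Section affine_change_of_variables.
Variable R : realType.
Notation mu := (@lebesgue_measure R).

Lemma measurable_affine (c d : R) :
  measurable_fun setT (fun x : R => c * x + d).
Proof. by apply: measurable_funD => //; exact: measurable_funM. Qed.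

(** Half-open intervals determine Lebesgue measure, and on them the claim is the scaling of
    lengths. *)
Lemma lebesgue_measure_affine (c d : R) (A : set R) : 0 < c -> measurable A ->
  mu A = (c%:E * pushforward mu (fun x : R => (c * x + d)%R) A)%E.
Proof.
move=> c0 mA.
have mf := measurable_affine c d.
pose f : measurableTypeR R -> measurableTypeR R := fun x => c * x + d.
have mf' : measurable_fun setT f by [].
pose k : {nonneg R} := NngNum (ltW c0).
pose nu  : {measure set (measurableTypeR R) -> \bar R} := mscale k (pushforward mu f).
rewrite (@lebesgue_measure_unique R (nu mf')) // => _ [[a b]] _ <-.
rewrite /nu /= /mscale /= /pushforward.
have -> : f @^-1` `]a, b] = `](a - d) / c, (b - d) / c]%classic.
  apply/seteqP; split=> x /=; rewrite !in_itv /= /f;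
   rewrite ltr_pdivrMr // ler_pdivlMr // (mulrC x) ltrBlDr lerBrDr //.
rewrite !lebesgue_measure_itv /= !lte_fin ltr_pM2r ?invr_gt0 // ltrD2r.
case: ifP => // _; last by rewrite mule0.
by rewrite -!EFinD -EFinM; congr EFin; field; rewrite gt_eqF.
Qed.

Lemma integral_affine (c d : R) (f : R -> \bar R) : 0 < c ->
  measurable_fun setT f -> (forall x, 0 <= f x)%E ->
  (\int[mu]_x f x = c%:E * \int[mu]_x f (c * x + d)%R)%E.
Proof.
move=> c0 mf f0.
pose g : measurableTypeR R -> measurableTypeR R := fun x => c * x + d.
have mg : measurable_fun setT g by exact: measurable_affine.
pose k : {nonneg R} := NngNum (ltW c0).
pose nu : {measure set (measurableTypeR R) -> \bar R} := mscale k (pushforward mu g).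
transitivity (\int[nu mg]_x f x)%E.
  by apply: eq_measure_integral => A mA _; exact: (lebesgue_measure_affine d c0 mA).
rewrite ge0_integral_mscale //= ge0_integral_pushforward //.
Qed.

(** The Radon-Nikodym derivative of the normal law and [normal_pdf] have the same integral over
    every measurable set, hence agree almost everywhere. *)
Lemma integral_normal_prob (m s : R) (f : R -> \bar R) :
  measurable_fun setT f -> (forall x, 0 <= f x)%E ->
  (\int[normal_prob m s]_x f x = \int[mu]_x (f x * (normal_pdf m s x)%:E))%E.
Proof.
move=> mf f0.
have dom := @normal_prob_dominates R m s.
rewrite -(Radon_Nikodym_SigmaFinite.change_of_variables dom f0 measurableT mf).
apply: ae_eq_integral => //.
- apply: emeasurable_funM => //.
  exact: measurable_int (Radon_Nikodym_SigmaFinite.f_integrable dom).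
- apply: emeasurable_funM => //.
  by apply/measurable_EFinP; exact: measurable_normal_pdf.
apply: ae_eqe_mul2l; apply: integral_ae_eq => //.
- exact: Radon_Nikodym_SigmaFinite.f_integrable.
- by apply/measurable_EFinP; exact: measurable_normal_pdf.
- by move=> E _ mE; rewrite -Radon_Nikodym_SigmaFinite.f_integral.
Qed.

End affine_change_of_variables.

(** * Change of measure between one-dimensional Gaussians *)

Section normal_density_ratio.
Variable R : realType.
Notation mu := (@lebesgue_measure R).
Notation N := (@normal_prob R 0 1).

Lemma std_normal_pdf (x : R) :
  normal_pdf 0 1 x = (Num.sqrt (pi *+ 2))^-1 * expR (- x ^+ 2 / 2).
Proof.
rewrite normal_pdfE ?oner_neq0 // /normal_peak /normal_fun.
by rewrite expr1n mul1r subr0 -[in RHS](mulr1n 1).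
Qed.

(** Substitute [u = (x + z) / s]: the density of [u] times the Jacobian [1 / s] is [lratio1 s x z]
    times the density of [z]. *)
Lemma normal_lratio1 (s x : R) (f : R -> \bar R) : 0 < s ->
  measurable_fun setT f -> (forall x, 0 <= f x)%E ->
  (\int[N]_u f (s * u)%R = \int[N]_z (f (x + z)%R * (lratio1 s x z)%:E))%E.
Proof.
move=> s0 mf f0.
have mfs : measurable_fun setT (fun u : R => f (s * u)).
  by apply: measurableT_comp => //; exact: measurable_funM.
have mfx : measurable_fun setT (fun u : R => f (x + u)).
  by apply: measurableT_comp => //; exact: measurable_funD.
have mpdf : measurable_fun setT (fun u : R => (normal_pdf 0 1 u)%:E).
  by apply/measurable_EFinP; exact: measurable_normal_pdf.
rewrite integral_normal_prob // integral_normal_prob; last 2 first.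
- apply: emeasurable_funM => //; apply/measurable_EFinP; exact: measurable_lratio1.
- by move=> z; rewrite mule_ge0 ?lee_fin ?lratio1_ge0.
rewrite (@integral_affine R s^-1 (s^-1 * x)) ?invr_gt0 //; last 2 first.
- exact: emeasurable_funM.
- by move=> z; rewrite mule_ge0 ?lee_fin ?normal_pdf_ge0.
rewrite -ge0_integralZl //.
- apply: eq_integral => z _.
  have -> : s * (s^-1 * z + s^-1 * x) = x + z by field; rewrite gt_eqF.
  rewrite muleCA -muleA; congr (_ * _)%E; rewrite -!EFinM; congr EFin.
  rewrite !std_normal_pdf /lratio1 mulrCA [RHS]mulrCA; congr (_ * _).
  rewrite -mulrA; congr (_ * _); rewrite -expRD; congr expR.
  by field; rewrite gt_eqF.
- apply: (@measurableT_comp _ _ _ _ _ _ (fun v : R => f (s * v)%R * (normal_pdf 0 1 v)%:E)%E).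
    exact: emeasurable_funM.
  exact: measurable_affine.
- by move=> z; rewrite mule_ge0 ?lee_fin ?normal_pdf_ge0.
- by rewrite lee_fin invr_ge0 ltW.
Qed.

Lemma integral_lratio1 (s x : R) : 0 < s -> (\int[N]_z (lratio1 s x z)%:E = 1)%E.
Proof.
move=> s0; have := @normal_lratio1 s x (cst 1%E) s0.
under [X in _ -> _ -> _ = X]eq_integral do rewrite mul1e.
by move=> <- //; rewrite integral_cst // mul1e; exact: probability_setT.
Qed.

End normal_density_ratio.

(** * Sums of independent Gaussians *)

Section normal_convolution.
Variable R : realType.
Notation N := (@normal_prob R 0 1).

(** A change of measure with [s = 1] moves the shift by [al * u] out of [f] and into a density.
    Tonelli then lets [u] be integrated first, and the mixture of densities so obtained is the ratio
    for standard deviation [ga / be]. *)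
Lemma normal_conv1 (al be ga : R) (f : R -> \bar R) :
  0 < be -> 0 < ga -> ga ^+ 2 = al ^+ 2 + be ^+ 2 ->
  measurable_fun setT f -> (forall x, 0 <= f x)%E ->
  (\int[N]_u \int[N]_v f (al * u + be * v)%R = \int[N]_u f (ga * u)%R)%E.
Proof.
move=> be0 ga0 gaE mf f0.
pose k := al / be; pose s := ga / be; pose t := be / ga.
have s0 : 0 < s by rewrite divr_gt0.
have t0 : 0 < t by rewrite divr_gt0.
have bN : be != 0 by rewrite gt_eqF.
have gN : ga != 0 by rewrite gt_eqF.
have tk : t ^+ 2 * (1 + k ^+ 2) = 1.
  by rewrite /t /k expr_div_n gaE; field; rewrite bN -gaE expf_neq0.
have ti : (2 * t ^+ 2)^-1 = (1 + k ^+ 2) / 2.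
  have t2N : t ^+ 2 != 0 by rewrite expf_neq0 // gt_eqF.
  by rewrite invfM mulrC; congr (_ / _); apply: (mulfI t2N); rewrite mulfV.
have step1 u : (\int[N]_v f (al * u + be * v)%R =
    \int[N]_z (f (be * z)%R * (lratio1 1 (- (k * u)) z)%:E))%E.
  pose g y := f (be * (k * u + y)).
  have := @normal_lratio1 R 1 (- (k * u)) g ltr01.
  rewrite /g => h.
  transitivity (\int[N]_v f (be * (k * u + 1 * v))%R)%E.
    apply: eq_integral => v _; congr f; rewrite /k; field; done.
  rewrite h //; last meas.
  by apply: eq_integral => z _; congr (f _ * _)%E; ring.
transitivity (\int[N]_u \int[N]_z (f (be * z)%R * (lratio1 1 (- (k * u)) z)%:E))%E.
  by apply: eq_integral => u _; exact: step1.
rewrite (fubini_tonelli (m1 := N) (m2 := N)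
   (fun p => f (be * p.2)%R * (lratio1 1 (- (k * p.1)) p.2)%:E)%E); last 2 first.
- rewrite /lratio1; meas.
- by move=> p; rewrite mule_ge0 // lee_fin lratio1_ge0.
rewrite /=.
transitivity (\int[N]_z (f (be * (0 + z))%R * (lratio1 s 0 z)%:E))%E; last first.
  rewrite -(@normal_lratio1 R s 0 (fun y => f (be * y))) //; last meas.
  by apply: eq_integral => u _; congr f; rewrite /s; field.
apply: eq_integral => z _.
rewrite add0r ge0_integralZl //=; last 2 first.
- rewrite /lratio1; meas.
- by move=> u _; rewrite lee_fin lratio1_ge0.
congr (_ * _)%E.
(* Completing the square in [u]: given [z], the variable [u] is Gaussian with mean [k * z * t ^+ 2]
   and variance [t ^+ 2], so the integrand is a constant times a likelihood ratio of integral 1. *)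
pose x' := - (k * z * t ^+ 2).
transitivity (\int[N]_u ((t * expR ((k * z * t) ^+ 2 / 2))%:E * (lratio1 t x' u)%:E))%E.
  apply: eq_integral => u _; rewrite -EFinM /lratio1; congr EFin.
  rewrite invr1 mul1r mulrACA mulfV ?gt_eqF // mul1r -expRD; congr expR.
  rewrite /x' expr1n mulr1 ti; apply/eqP; rewrite -subr_eq0; apply/eqP.
  transitivity (((k * z * t) ^+ 2 / 2 - k * z * u) * (t ^+ 2 * (1 + k ^+ 2) - 1)); first by field.
  by rewrite tk subrr mulr0.
rewrite ge0_integralZl //=; last 3 first.
- by apply/measurable_EFinP; exact: measurable_lratio1.
- by move=> u _; rewrite lee_fin lratio1_ge0.
- by rewrite lee_fin mulr_ge0 ?expR_ge0 // ltW.
rewrite integral_lratio1 // mule1; congr EFin; rewrite /lratio1.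
have st : s^-1 = t by rewrite /s /t invf_div.
rewrite st; congr (_ * expR _).
rewrite invfM -exprVn st add0r; apply/eqP; rewrite -subr_eq0; apply/eqP.
transitivity (z ^+ 2 / 2 * (t ^+ 2 * (1 + k ^+ 2) - 1)); first by field.
by rewrite tk subrr mulr0.
Qed.

End normal_convolution.

(** * Second moments of the normal law *)

Section normal_moments.
Variable R : realType.
Notation mu := (@lebesgue_measure R).
Notation N := (@normal_prob R 0 1).

Lemma normal_opp (f : R -> \bar R) :
  measurable_fun setT f -> (forall x, 0 <= f x)%E ->
  (\int[N]_z f (- z)%R = \int[N]_z f z)%E.
Proof.
move=> mf f0.
have mpdf : measurable_fun setT (fun u : R => (normal_pdf 0 1 u)%:E).
  by apply/measurable_EFinP; exact: measurable_normal_pdf.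
have mo : measurable_fun setT (-%R : measurableTypeR R -> measurableTypeR R).
  exact: oppr_measurable.
rewrite !integral_normal_prob //; last meas.
pose g z := (f (- z)%R * (normal_pdf 0 1 z)%:E)%E.
have mg : measurable_fun setT g by rewrite /g; meas.
transitivity (\int[pushforward mu (-%R : measurableTypeR R -> measurableTypeR R)]_x g x)%E.
  by apply: eq_measure_integral => A mA _; rewrite [RHS]lebesgue_measureN.
rewrite (ge0_integral_pushforward mo mu measurableT mg); last first.
  by move=> z _; rewrite mule_ge0 ?lee_fin ?normal_pdf_ge0.
rewrite preimage_setT; apply: eq_integral => z _.
by rewrite /g /= opprK !std_normal_pdf sqrrN.
Qed.

(** The exponential moment of a chi-square variable, read off the total mass of [lratio1 s 0]. *)
Lemma normal_exp_sq (s : R) : 0 < s ->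
  (\int[N]_z (expR (z ^+ 2 * (1 - s ^- 2) / 2))%:E = s%:E)%E.
Proof.
move=> s0; have := @integral_lratio1 R s 0 s0.
under eq_integral do rewrite EFinM.
rewrite ge0_integralZl //=; last 2 first.
- meas.
- by rewrite lee_fin invr_ge0 ltW.
move=> /(congr1 (fun y => s%:E * y)%E).
rewrite muleA -EFinM mulfV ?gt_eqF // mul1e mule1 => <-.
apply: eq_integral => z _; congr (expR _)%:E; rewrite add0r; field.
by rewrite gt_eqF.
Qed.

(** From [exp y >= 1 + y] and [normal_exp_sq]: [s = 1 + e] gives [1 + l * m <= s], and [s = 1 - e]
    gives [1 <= l * m + s], where [l] is close to [e]. Then [e] tends to 0. *)
Lemma normal_sq : (\int[N]_z (z ^+ 2)%:E = 1)%E.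
Proof.
set m := (\int[N]_z _)%E.
have m0 : (0 <= m)%E by apply: integral_ge0 => z _; rewrite lee_fin sqr_ge0.
have ub (e : R) : 0 < e -> (m <= (1 + 2 * e)%:E)%E.
  move=> e0; pose s := 1 + e; pose l := (1 - s ^- 2) / 2.
  have s1 : 1 < s by rewrite /s; lra.
  have l0 : 0 < l.
    by rewrite divr_gt0 // subr_gt0 invf_lt1 ?exprn_gt0 ?exprn_egt1 //; lra.
  have : (\int[N]_z (l * z ^+ 2 + 1)%:E <= s%:E)%E.
    rewrite -normal_exp_sq; last lra.
    apply: ge0_le_integral => //.
    - by move=> z _; rewrite lee_fin addr_ge0 // mulr_ge0 ?sqr_ge0 // ltW.
    - meas.
    - meas.
    - move=> z _; rewrite lee_fin addrC -mulrA -/l (mulrC (z ^+ 2)).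
      exact: expR_ge1Dx.
  under eq_integral do rewrite EFinD.
  rewrite ge0_integralD; try side.
  under eq_integral do rewrite EFinM.
  rewrite ge0_integralZl; try side.
  rewrite prob_integral_cst -/m.
  move: m0; case: m => [r| |] //=.
    rewrite !lee_fin => r0 h.
    have h2 : l * r <= e by move: h; rewrite /s; lra.
    have h3 : e <= l * (1 + 2 * e).
      have -> : l = e * (2 + e) / (2 * s ^+ 2).
        by rewrite /l /s; field; rewrite gt_eqF //; lra.
      rewrite mulrAC ler_pdivlMr ?mulr_gt0 ?exprn_gt0; try lra.
      by rewrite /s; nra.
    by rewrite -(ler_pM2l l0); exact: le_trans h2 h3.
  by rewrite gt0_muley ?lte_fin.
have lb (e : R) : 0 < e -> e < 1 -> ((1 - 2 * e)%:E <= m)%E.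
  move=> e0 e1; pose s := 1 - e; pose l := (s ^- 2 - 1) / 2.
  have s1 : s < 1 by rewrite /s; lra.
  have s0 : 0 < s by rewrite /s; lra.
  have l0 : 0 < l.
    by rewrite divr_gt0 // subr_gt0 invf_gt1 ?exprn_gt0 ?exprn_ilt1 //; lra.
  have key (z : R) : 1 <= l * z ^+ 2 + expR (z ^+ 2 * (1 - s ^- 2) / 2).
    have -> : z ^+ 2 * (1 - s ^- 2) / 2 = - (l * z ^+ 2) by rewrite /l; field; rewrite gt_eqF.
    by have := expR_ge1Dx (- (l * z ^+ 2)); lra.
  have : (\int[N]_z (cst 1%E z) <= \int[N]_z ((l * z ^+ 2)%:E + (expR (z ^+ 2 * (1 - s ^- 2) / 2))%:E))%E.
    apply: ge0_le_integral; try side.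
    by move=> z _ /=; rewrite -EFinD lee_fin.
  rewrite prob_integral_cst.
  rewrite ge0_integralD; try side.
  rewrite normal_exp_sq //.
  under eq_integral do rewrite EFinM.
  rewrite ge0_integralZl; try side.
  rewrite -/m; clear ub; move: m0; case: m => [r| |] //=.
    rewrite -EFinM -EFinD !lee_fin => r0 h.
    have h2 : e <= l * r by move: h; rewrite /s; lra.
    have h3 : l * (1 - 2 * e) <= e.
      have -> : l = e * (2 - e) / (2 * s ^+ 2).
        by rewrite /l /s; field; rewrite gt_eqF //; lra.
      rewrite mulrAC ler_pdivrMr ?mulr_gt0 ?exprn_gt0; try lra.
      by rewrite /s; nra.
    by rewrite -(ler_pM2l l0); exact: le_trans h3 h2.
  by move=> _ _; rewrite leey.
move: m0 ub lb; case: m => [r| |] // _ ub lb.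
  congr EFin; apply/eqP; rewrite eq_le; apply/andP; split; apply/ler_addgt0Pr => d d0.
    have := ub (d / 2); rewrite lee_fin divr_gt0 // => /(_ isT).
    by rewrite mulrCA mulfV ?mulr1 // pnatr_eq0.
  have e'0 : 0 < Num.min (d / 2) 2^-1 by rewrite lt_min; lra.
  have e'1 : Num.min (d / 2) 2^-1 < 1 by rewrite gt_min; apply/orP; right; lra.
  have := lb _ e'0 e'1; rewrite lee_fin.
  have : Num.min (d / 2) 2^-1 <= d / 2 by rewrite ge_min lexx.
  lra.
by have := ub 1 ltr01; rewrite leye_eq.
Qed.

(** By symmetry [(x + z)^2] and [(x - z)^2] have equal integrals, and their sum has no cross term;
    only nonnegative functions are integrated. *)
Lemma normal_sqD (x : R) : (\int[N]_z ((x + z) ^+ 2)%:E = (x ^+ 2 + 1)%:E)%E.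
Proof.
have e : (\int[N]_z ((x + z) ^+ 2)%:E = \int[N]_z ((x - z) ^+ 2)%:E)%E.
  by rewrite -(@normal_opp (fun z => ((x + z) ^+ 2)%:E)) //; side.
have : (\int[N]_z ((x + z) ^+ 2)%:E + \int[N]_z ((x - z) ^+ 2)%:E =
        (2 * (x ^+ 2 + 1))%:E)%E.
  rewrite -ge0_integralD; try side.
  transitivity (\int[N]_z ((2 * x ^+ 2)%:E + 2%:E * (z ^+ 2)%:E))%E.
    by apply: eq_integral => z _; rewrite -EFinM -!EFinD; congr EFin; ring.
  rewrite ge0_integralD; try side.
  rewrite prob_integral_cst ge0_integralZl; try side.
  by rewrite normal_sq mule1 -EFinD; congr EFin; ring.
rewrite -e; case: (\int[N]_z ((x + z) ^+ 2)%:E)%E => //= r [] h; congr EFin; lra.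
Qed.

End normal_moments.

(** * The standard Gaussian measure on tuples *)

Section gauss_measure.
Variable R : realType.
Notation N := (@normal_prob R 0 1).

Definition tcons n (p : measurableTypeR R * n.-tuple R) : n.+1.-tuple R := cons_tuple p.1 p.2.

Lemma measurable_tcons n : measurable_fun setT (@tcons n).
Proof.
apply: (@measurable_cons _ _ _ _ (fun p : measurableTypeR R * n.-tuple R => p.1 : R)
  n (fun p => p.2)).
- exact: measurable_fst.
- exact: measurable_snd.
Qed.

HB.instance Definition _ n := isMeasurableFun.Build _ _ _ _ (@tcons n) (@measurable_tcons n).

(** A genuine probability measure, so that Tonelli and linearity apply to vectors as wholes;
    [gauss_intE] relates it to the iterated integral [gauss_int]. *)
Fixpoint gauss n : probability (n.-tuple R) R :=
  match n with
  | 0 => [the probability _ _ of @dirac _ (0.-tuple R) [tuple] R]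
  | m.+1 => [the probability _ _ of distribution (N \x gauss m)%E (@tcons m)]
  end.

Lemma gauss0 (f : 0.-tuple R -> \bar R) : measurable_fun setT f ->
  (\int[gauss 0]_z f z = f [tuple])%E.
Proof. by move=> mf; rewrite integral_dirac // diracT mul1e. Qed.

Lemma gaussS n (f : n.+1.-tuple R -> \bar R) : measurable_fun setT f ->
  (forall z, 0 <= f z)%E ->
  (\int[gauss n.+1]_z f z = \int[N]_x \int[gauss n]_t f (cons_tuple x t))%E.
Proof.
move=> mf f0; rewrite /= ge0_integral_distribution //.
rewrite (fubini_tonelli1 (f \o @tcons n)) //.
  by apply: measurableT_comp => //; exact: measurable_tcons.
by move=> p /=; exact: f0.
Qed.

Lemma gauss_intE n (f : n.-tuple R -> \bar R) : measurable_fun setT f ->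
  (forall z, 0 <= f z)%E -> gauss_int f = (\int[gauss n]_z f z)%E.
Proof.
elim: n f => [|n IH] f mf f0; first by rewrite gauss0.
rewrite gaussS //=; apply: eq_integral => x _; rewrite IH //.
apply: measurableT_comp => //; apply: measurable_cons_tuple => //.
Qed.

End gauss_measure.

(** * Change of measure, convolution and energy for Gaussian vectors *)

Section gauss_change_of_variables.
Variable R : realType.
Notation N := (@normal_prob R 0 1).

(** Induction on the dimension: the likelihood ratio is a product over coordinates, and
    [normal_lratio1] treats the first one. *)
Lemma gauss_lratio n (s : R) (x : n.-tuple R) (f : n.-tuple R -> \bar R) : 0 < s ->
  measurable_fun setT f -> (forall x, 0 <= f x)%E ->
  (\int[gauss R n]_u f (tscale s u) = \int[gauss R n]_z (f (tadd x z) * (lratio s x z)%:E))%E.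
Proof.
move=> s0; have sN : s != 0 by rewrite gt_eqF.
elim: n x f => [|n IH] x f mf f0.
  rewrite !gauss0; try side.
  rewrite (tuple0 x) /lratio expr0 invr1 mul1r /sqnorm !big_ord0 !mul0r subr0 expR0 mule1.
  by congr f; apply: eq_from_tnth => -[].
case/tupleP: x => x0 x.
rewrite !gaussS; try side.
pose F y := (\int[gauss R n]_z (f (cons_tuple y (tadd x z)) * (lratio s x z)%:E))%E.
have F0 y : (0 <= F y)%E by rewrite /F; pos.
have mF : measurable_fun setT F by rewrite /F; meas.
transitivity (\int[N]_u F (s * u)%R)%E.
  apply: eq_integral => u _; rewrite /F -(IH x (fun y => f (cons_tuple (s * u) y))); try side.
  by apply: eq_integral => z _; rewrite tscale_cons.
rewrite (@normal_lratio1 R s x0 F s0 mF F0); apply: eq_integral => z0 _.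
rewrite /F muleC -ge0_integralZl; try side.
apply: eq_integral => z _.
rewrite tadd_cons lratio_cons // muleCA EFinM.
by rewrite muleA.
Qed.

Lemma integral_lratio n (s : R) (x : n.-tuple R) : 0 < s ->
  (\int[gauss R n]_z (lratio s x z)%:E = 1)%E.
Proof.
move=> s0; have := @gauss_lratio n s x (cst 1%E) s0.
under [X in _ -> _ -> _ = X]eq_integral do rewrite mul1e.
by move=> <- //; exact: prob_integral_cst.
Qed.

Lemma gauss_conv n (al be ga : R) (f : n.-tuple R -> \bar R) :
  0 < be -> 0 < ga -> ga ^+ 2 = al ^+ 2 + be ^+ 2 ->
  measurable_fun setT f -> (forall x, 0 <= f x)%E ->
  (\int[gauss R n]_u \int[gauss R n]_v f (tadd (tscale al u) (tscale be v)) =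
   \int[gauss R n]_u f (tscale ga u))%E.
Proof.
move=> be0 ga0 gaE; elim: n f => [|n IH] f mf f0.
  rewrite !gauss0; try side.
  by congr f; apply: eq_from_tnth => -[].
rewrite !gaussS; try side.
pose F y := (\int[gauss R n]_z f (cons_tuple y (tscale ga z)))%E.
have F0 y : (0 <= F y)%E by rewrite /F; pos.
have mF : measurable_fun setT F by rewrite /F; meas.
transitivity (\int[N]_u F (ga * u)%R)%E; last first.
  by apply: eq_integral => u _; apply: eq_integral => z _; rewrite tscale_cons.
rewrite -(@normal_conv1 R al be) //; apply: eq_integral => u0 _.
(* The first coordinate [v0] of the second vector is moved by Tonelli past the tail [u] of the
   first, so that the induction hypothesis applies to the two tails. *)
transitivity (\int[gauss R n]_u \int[N]_v0 \int[gauss R n]_v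
    f (cons_tuple (al * u0 + be * v0)%R (tadd (tscale al u) (tscale be v))))%E.
  apply: eq_integral => u _; rewrite gaussS; try side.
  apply: eq_integral => v0 _; apply: eq_integral => v _.
  by rewrite !tscale_cons tadd_cons.
rewrite (@fubini_tonelli _ _ _ _ R (gauss R n) N (fun p => \int[gauss R n]_v
    f (cons_tuple (al * u0 + be * p.2)%R (tadd (tscale al p.1) (tscale be v))))%E); try side.
apply: eq_integral => v0 _ /=; rewrite /F -(IH (fun y => f (cons_tuple (al * u0 + be * v0)%R y))) //.
side.
Qed.

Lemma gauss_sqnorm n (x : n.-tuple R) :
  (\int[gauss R n]_z (sqnorm (tadd x z))%:E = (sqnorm x + n%:R)%:E)%E.
Proof.
elim: n x => [|n IH] x.
  by rewrite gauss0; [rewrite /sqnorm !big_ord0 addr0 | side].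
case/tupleP: x => x0 x.
rewrite gaussS; try side.
transitivity (\int[N]_z0 (((x0 + z0) ^+ 2)%:E + (sqnorm x + n%:R)%:E))%E.
  apply: eq_integral => z0 _; rewrite -IH.
  rewrite -(prob_integral_cst (gauss R n) ((x0 + z0) ^+ 2)%:E) -ge0_integralD; try side.
  by apply: eq_integral => z _; rewrite tadd_cons sqnorm_cons EFinD.
rewrite ge0_integralD; try side.
rewrite prob_integral_cst normal_sqD -EFinD; congr EFin.
rewrite [in RHS]sqnorm_cons -(natr1 n); ring.
Qed.

End gauss_change_of_variables.

(** * Converse *)

Section tilted_density.
Variable R : realType.
Notation G := (gauss R).

(* [A] and [B] play the role of the conditional laws of the messages given the channel
   outputs, scaled by the number of messages; the two [lratio] factors turn the true law of the
   outputs into the reference one.  Hence the sum is the total mass of the reference law. *)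
Lemma sum_tilted_density n (I J : finType) (A : I -> n.-tuple R -> R)
    (B : J -> n.-tuple R -> R) (x1 : I -> n.-tuple R) (x2 : J -> n.-tuple R)
    (mu : n.-tuple R) (a b s1 s2 v cA cB : R) :
  0 < b -> 0 < s1 -> 0 < s2 -> 0 < v -> v ^+ 2 = (a * s1) ^+ 2 + b ^+ 2 ->
  (forall i, measurable_fun setT (A i)) -> (forall j, measurable_fun setT (B j)) ->
  (forall i y, 0 <= A i y) -> (forall j y, 0 <= B j y) ->
  (forall y, \sum_i A i y = cA) -> (forall y, \sum_j B j y = cB) ->
  0 <= cA ->
  (\sum_i \sum_j \int[G n]_z \int[G n]_z'
    (A i (tadd (x1 i) z) *
     B j (tadd (x2 j) (tadd (tscale a (tadd (x1 i) z)) (tscale b z'))) *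
     lratio s1 (x1 i) z *
     lratio s2 (tscale v^-1 (tadd (x2 j) (tscale (-1) mu)))
       (tscale v^-1 (tadd (tscale a (tadd (x1 i) z)) (tscale b z'))))%:E
   = (cA * cB)%:E)%E.
Proof.
move=> b0 s10 s20 v0 vE mA mB A0 B0 sA sB cA0.
(* [s] is the interference plus noise [Y2 - X2]; [H] gathers the factors that depend on the noises
   only through it. *)
pose H j s := (B j (tadd (x2 j) s) *
  lratio s2 (tscale v^-1 (tadd (x2 j) (tscale (-1) mu))) (tscale v^-1 s))%:E.
have mH j : measurable_fun setT (H j).
  have := mB j; rewrite /H => mBj; meas.
have H0 j s : (0 <= H j s)%E by rewrite lee_fin mulr_ge0 // ltW // lratio_gt0.
have HE j s : H j s = (B j (tadd (x2 j) s) *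
  lratio s2 (tscale v^-1 (tadd (x2 j) (tscale (-1) mu))) (tscale v^-1 s))%:E by [].
clearbody H.
(* When [s] has variance [v ^+ 2], the second ratio gives [Y2] the law N(mu, (v s2)^2), whichever
   codeword [x2 j] was sent. *)
have eH j : (\int[G n]_u H j (tscale v u) =
    \int[G n]_u (B j (tadd mu (tscale v (tscale s2 u))))%:E)%E.
  have mBj := mB j.
  rewrite [RHS](@gauss_lratio R n s2 (tscale v^-1 (tadd (x2 j) (tscale (-1) mu)))
     (fun y => (B j (tadd mu (tscale v y)))%:E) s20); last 2 first.
  - meas.
  - by move=> y; rewrite lee_fin.
  apply: eq_integral => u _; rewrite HE -EFinM; congr EFin; congr (_ * _).
  - by congr (B j _); tup; field; rewrite gt_eqF.
  - by congr (lratio _ _ _); tup; field; rewrite gt_eqF.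
(* Likewise the first ratio gives [Y1] the law N(0, s1^2) for every [i]. *)
have e1 i j : (\int[G n]_z \int[G n]_z'
    (A i (tadd (x1 i) z) *
     B j (tadd (x2 j) (tadd (tscale a (tadd (x1 i) z)) (tscale b z'))) *
     lratio s1 (x1 i) z *
     lratio s2 (tscale v^-1 (tadd (x2 j) (tscale (-1) mu)))
       (tscale v^-1 (tadd (tscale a (tadd (x1 i) z)) (tscale b z'))))%:E =
   \int[G n]_u ((A i (tscale s1 u))%:E *
      \int[G n]_z' H j (tadd (tscale (a * s1) u) (tscale b z'))))%E.
  have mAi := mA i; have mHj := mH j; have mBj := mB j.
  pose f y := ((A i y)%:E * \int[G n]_z' H j (tadd (tscale a y) (tscale b z')))%E.
  transitivity (\int[G n]_z (f (tadd (x1 i) z) * (lratio s1 (x1 i) z)%:E))%E.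
    apply: eq_integral => z _; rewrite /f muleC muleA -EFinM -ge0_integralZl; try side.
    by apply: eq_integral => z' _; rewrite HE -!EFinM; congr EFin; ring.
  rewrite -(@gauss_lratio R n s1 (x1 i) f s10); last 2 first.
  - rewrite /f; meas.
  - by move=> y; rewrite /f mule_ge0 ?lee_fin //; pos.
  apply: eq_integral => u _; rewrite /f.
  suff -> : tscale a (tscale s1 u) = tscale (a * s1) u by [].
  by tup; ring.
under eq_bigr do under eq_bigr do rewrite e1.
rewrite exchange_big /=.
(* The sum over [i] now only meets [A], and gives [cA]; then [a * s1 * u] and [b * z'] merge into
   one Gaussian of standard deviation [v]. *)
have e2 j : (\sum_i \int[G n]_u ((A i (tscale s1 u))%:E *
      \int[G n]_z' H j (tadd (tscale (a * s1) u) (tscale b z'))) =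
    cA%:E * \int[G n]_u (B j (tadd mu (tscale v (tscale s2 u))))%:E)%E.
  have mHj := mH j.
  rewrite -eH -(@gauss_conv R n (a * s1) b v) //.
  rewrite -ge0_integralZl; try side.
  rewrite -ge0_integral_sum //; last 2 first.
  - by move=> i; have mAi := mA i; meas.
  - by move=> i u _; rewrite mule_ge0 ?lee_fin //; pos.
  apply: eq_integral => u _; rewrite -ge0_sume_distrl; last first.
    by move=> i _; rewrite lee_fin.
  by rewrite sumEFin sA.
under eq_bigr do rewrite e2.
rewrite -ge0_sume_distrr; last first.
  by move=> j _; apply: integral_ge0 => u _; rewrite lee_fin.
rewrite EFinM; congr (_ * _)%E.
rewrite -ge0_integral_sum //; last 2 first.
- by move=> j; have mBj := mB j; meas.
- by move=> j u _; rewrite lee_fin.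
under eq_integral do rewrite sumEFin sB.
exact: prob_integral_cst.
Qed.

End tilted_density.

(** * Centering of codewords, smoothed decoding laws, coupling of the noises *)

Section centering.
Variable R : realType.
Notation G := (gauss R).

(** For independent uniform indices, the variance of [p + q] is at most the sum of the second
    moments; the gap consists of the squares of the two means. *)
Lemma sum_centered_sq (I J : finType) (q : I -> R) (p : J -> R) :
  (0 < #|I|)%N -> (0 < #|J|)%N ->
  \sum_i \sum_j (p j + q i - ((\sum_j p j) / #|J|%:R + (\sum_i q i) / #|I|%:R)) ^+ 2
  <= #|I|%:R * (\sum_j p j ^+ 2) + #|J|%:R * (\sum_i q i ^+ 2).
Proof.
move=> I0 J0; have iN : #|I|%:R != 0 :> R by rewrite pnatr_eq0 -lt0n.
have jN : #|J|%:R != 0 :> R by rewrite pnatr_eq0 -lt0n.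
set Sp := \sum_j p j; set Sq := \sum_i q i; set c := Sp / _ + Sq / _.
have cst (K : finType) (y : R) : #|K|%:R * y = \sum_(k : K) y.
  by rewrite sumr_const mulr_natl.
have e i : \sum_j (p j + q i - c) ^+ 2 =
    \sum_j p j ^+ 2 + 2 * (q i - c) * Sp + #|J|%:R * (q i - c) ^+ 2.
  rewrite cst /Sp mulr_sumr -!big_split /=.
  by apply: eq_bigr => j _; ring.
under eq_bigr do rewrite e.
have -> : \sum_i (\sum_j p j ^+ 2 + 2 * (q i - c) * Sp + #|J|%:R * (q i - c) ^+ 2) =
   #|I|%:R * (\sum_j p j ^+ 2) + #|J|%:R * (\sum_i q i ^+ 2) + (2 * Sp - 2 * #|J|%:R * c) * Sq
    + #|I|%:R * (#|J|%:R * c ^+ 2 - 2 * c * Sp).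
  transitivity (\sum_(i : I) (\sum_j p j ^+ 2) + \sum_i (#|J|%:R * q i ^+ 2) +
    \sum_i ((2 * Sp - 2 * #|J|%:R * c) * q i) + \sum_(i : I) (#|J|%:R * c ^+ 2 - 2 * c * Sp)).
    rewrite -!big_split /=; apply: eq_bigr => i _; ring.
  by rewrite -!mulr_sumr -!cst.
rewrite -subr_ge0.
have -> : #|I|%:R * (\sum_j p j ^+ 2) + #|J|%:R * (\sum_i q i ^+ 2) -
  (#|I|%:R * (\sum_j p j ^+ 2) + #|J|%:R * (\sum_i q i ^+ 2) + (2 * Sp - 2 * #|J|%:R * c) * Sq
    + #|I|%:R * (#|J|%:R * c ^+ 2 - 2 * c * Sp)) =
  #|I|%:R * Sp ^+ 2 / #|J|%:R + #|J|%:R * Sq ^+ 2 / #|I|%:R.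
  by rewrite /c; field; rewrite iN jN.
by rewrite addr_ge0 // divr_ge0 // mulr_ge0 // sqr_ge0.
Qed.

(* Codewords need not have zero mean, so the cross term between users 1 and 2 only
   disappears from the power of the received signal after centering. *)
Lemma exists_centering n (I J : finType) (a P1 P2 : R)
    (x1 : I -> n.-tuple R) (x2 : J -> n.-tuple R) :
  (0 < #|I|)%N -> (0 < #|J|)%N ->
  (forall i, sqnorm (x1 i) <= n%:R * P1) -> (forall j, sqnorm (x2 j) <= n%:R * P2) ->
  exists mu, \sum_i \sum_j sqnorm (tadd (tadd (x2 j) (tscale (-1) mu)) (tscale a (x1 i)))
    <= #|I|%:R * #|J|%:R * (n%:R * (P2 + a ^+ 2 * P1)).
Proof.
move=> I0 J0 p1 p2.
(* The witness is the mean of [X2 + a X1] over the messages. *)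
exists [tuple (\sum_j tnth (x2 j) t) / #|J|%:R + (\sum_i a * tnth (x1 i) t) / #|I|%:R | t < n].
apply: (@le_trans _ _ (#|I|%:R * (\sum_j sqnorm (x2 j)) + #|J|%:R * (\sum_i sqnorm (tscale a (x1 i))))).
  rewrite /sqnorm; under eq_bigr do rewrite exchange_big /=.
  rewrite exchange_big /= [X in _ <= _ * X + _]exchange_big /= [X in _ <= _ + _ * X]exchange_big /=.
  rewrite !mulr_sumr -big_split /=; apply: ler_sum => t _.
  have := @sum_centered_sq I J (fun i => a * tnth (x1 i) t) (fun j => tnth (x2 j) t) I0 J0.
  congr (_ <= _).
    by apply: eq_bigr => i _; apply: eq_bigr => j _; rewrite !tnth_mktuple; ring.
  by congr (_ + _ * _); apply: eq_bigr => i _; rewrite tnth_mktuple.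
have h2 : \sum_j sqnorm (x2 j) <= #|J|%:R * (n%:R * P2).
  by rewrite mulr_natl -sumr_const; apply: ler_sum => j _.
have h1 : \sum_i sqnorm (tscale a (x1 i)) <= #|I|%:R * (a ^+ 2 * (n%:R * P1)).
  rewrite mulr_natl -sumr_const; apply: ler_sum => i _.
  by rewrite sqnorm_scale ler_wpM2l ?sqr_ge0.
have -> : #|I|%:R * #|J|%:R * (n%:R * (P2 + a ^+ 2 * P1)) =
  #|I|%:R * (#|J|%:R * (n%:R * P2)) + #|J|%:R * (#|I|%:R * (a ^+ 2 * (n%:R * P1))) by ring.
by apply: lerD; apply: ler_wpM2l.
Qed.

Lemma measurable_dec d (T : measurableType d) n M (f : T -> n.-tuple R)
    (dec : n.-tuple R -> 'I_M) (m : 'I_M) :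
  (forall m, measurable (dec @^-1` [set m])) -> measurable_fun setT f ->
  measurable_fun setT (fun x => (dec (f x) == m)%:R : R).
Proof.
move=> mdec mf.
have -> : (fun x => (dec (f x) == m)%:R : R) = \1_(dec @^-1` [set m]) \o f.
  apply/funext => x /=; rewrite indicE; congr (_%:R); congr nat_of_bool.
  by apply/eqP/idP => [e|]; [rewrite inE | rewrite inE].
exact: (measurableT_comp (measurable_indic (mdec m)) mf).
Qed.

(** [(c * M + 1) / 2] is [M] times an equal mixture of the point mass at the decoded message and the
    uniform law. The mixture keeps the logarithm finite on a decoding error, at a price of
    [ln 2]. *)
Lemma ln_half_succ (c : bool) (M : R) : 1 <= M ->
  c%:R * ln M - ln 2 <= ln ((c%:R * M + 1) / 2).
Proof.
move=> M1; have M0 : 0 < M by exact: lt_le_trans M1.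
rewrite ln_div ?posrE //; last by case: c; rewrite /= ?mul1r ?mul0r; lra.
rewrite lerD2r; case: c; rewrite /= ?mul1r ?mul0r ?add0r ?ln1 //.
by rewrite ler_ln ?posrE //; lra.
Qed.

(** As [a^2 + b^2 = 1], the vector [a z + b z'] is again standard Gaussian: building the noise of
    receiver 2 from that of receiver 1 preserves the law of [Y2]. *)
Lemma gauss_couple n (a b : R) (x : n.-tuple R) (g : n.-tuple R -> \bar R) :
  0 < b -> a ^+ 2 + b ^+ 2 = 1 -> measurable_fun setT g -> (forall y, 0 <= g y)%E ->
  (\int[G n]_z \int[G n]_z' g (tadd (tscale a (tadd x z)) (tscale b z')) =
   \int[G n]_u g (tadd (tscale a x) u))%E.
Proof.
move=> b0 ab mg g0.
pose f y := g (tadd (tscale a x) y).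
transitivity (\int[G n]_u f (tscale 1 u))%E; last first.
  by apply: eq_integral => u _; rewrite /f; congr (g (tadd _ _)); tup; rewrite mul1r.
have e1 : 1 ^+ 2 = a ^+ 2 + b ^+ 2 by rewrite expr1n.
have mf : measurable_fun setT f by rewrite /f; meas.
rewrite -(@gauss_conv R n a b 1 f b0 ltr01 e1 mf); last by move=> y; exact: g0.
apply: eq_integral => z _; apply: eq_integral => z' _; rewrite /f; congr (g _).
by tup; ring.
Qed.

Lemma gauss_sqnorm0 n : (\int[G n]_z (sqnorm z)%:E = n%:R%:E)%E.
Proof.
have := @gauss_sqnorm R n [tuple 0 | i < n].
have -> : sqnorm [tuple (0:R) | i < n] = 0.
  by rewrite /sqnorm big1 // => i _; rewrite tnth_mktuple expr0n.
rewrite add0r => <-; apply: eq_integral => z _; congr (sqnorm _)%:E.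
by tup; rewrite add0r.
Qed.

End centering.

(** * Converse for the Z-channel of users 1 and 2 *)

Section z_channel_converse.
Variable R : realType.
Notation G := (gauss R).

Lemma gauss_pair n (F : n.-tuple R -> n.-tuple R -> \bar R) :
  measurable_fun setT (fun p => F p.1 p.2) -> (forall x y, 0 <= F x y)%E ->
  (\int[G n \x G n]_p F p.1 p.2 = \int[G n]_z \int[G n]_z' F z z')%E.
Proof.
move=> mF F0; exact: (@fubini_tonelli1 _ _ _ _ R (G n) (G n) (fun p => F p.1 p.2) mF
  (fun p => F0 p.1 p.2)).
Qed.

Lemma gauss_sqnorm_div n (x : n.-tuple R) (c : R) : 0 < c ->
  (\int[G n]_z (sqnorm (tadd x z) / c)%:E = ((sqnorm x + n%:R) / c)%:E)%E.
Proof.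
move=> c0; under eq_integral do rewrite mulrC EFinM.
rewrite ge0_integralZl; try side.
by rewrite gauss_sqnorm -EFinM mulrC.
Qed.

Lemma gauss_sqnorm0_div n (c : R) : 0 < c ->
  (\int[G n]_z (sqnorm z / c)%:E = (n%:R / c)%:E)%E.
Proof.
move=> c0; under eq_integral do rewrite mulrC EFinM.
rewrite ge0_integralZl; try side.
by rewrite gauss_sqnorm0 -EFinM mulrC.
Qed.

(** The inequality [1 + ln T <= T] is integrated and summed over the messages, where [T] is the
    density ratio of [sum_tilted_density]. The total mass of [T] is known, and the remaining terms
    of [ln T] only involve energies. *)
Lemma zic_converse n M1 M2 (a P1 P2 : R)
    (x1 : 'I_M1 -> n.-tuple R) (x2 : 'I_M2 -> n.-tuple R)
    (d1 : n.-tuple R -> 'I_M1) (d2 : n.-tuple R -> 'I_M2) :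
  (0 < M1)%N -> (0 < M2)%N -> a ^+ 2 < 1 -> 0 <= P1 -> 0 <= P2 ->
  (forall i, sqnorm (x1 i) <= n%:R * P1) -> (forall j, sqnorm (x2 j) <= n%:R * P2) ->
  (forall m, measurable (d1 @^-1` [set m])) -> (forall m, measurable (d2 @^-1` [set m])) ->
  (\sum_i \sum_j
     (\int[G n]_z ((d1 (tadd (x1 i) z) == i)%:R * ln M1%:R)%:E +
      \int[G n]_z ((d2 (tadd (tadd (x2 j) (tscale a (x1 i))) z) == j)%:R * ln M2%:R)%:E)
   <= (M1%:R * M2%:R * (n%:R * ((ln (1 + P1) + ln (1 + P2 / (1 + a ^+ 2 * P1))) / 2)
        + 2 * ln 2))%:E)%E.
Proof.
move=> M10 M20 a1 P10 P20 pw1 pw2 md1 md2.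
have lM1 : 0 <= ln M1%:R :> R by rewrite ln_ge0 // ler1n.
have lM2 : 0 <= ln M2%:R :> R by rewrite ln_ge0 // ler1n.
have I1 : (0 < #|'I_M1|)%N by rewrite card_ord.
have I2 : (0 < #|'I_M2|)%N by rewrite card_ord.
have [mu hmu] := @exists_centering R n 'I_M1 'I_M2 a P1 P2 x1 x2 I1 I2 pw1 pw2.
rewrite !card_ord in hmu.
(* The variance of the interference plus noise at receiver 2 when user 1 uses full power. *)
pose V := 1 + a ^+ 2 * P1.
have V0 : 0 < V by rewrite /V; have := mulr_ge0 (sqr_ge0 a) P10; lra.
pose b := Num.sqrt (1 - a ^+ 2).
have b0 : 0 < b by rewrite sqrtr_gt0; lra.
have bE : b ^+ 2 = 1 - a ^+ 2 by rewrite sqr_sqrtr; lra.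
(* Under the reference law [Y1] has variance [s1 ^+ 2 = 1 + P1], and [Y2] has variance
   [v ^+ 2 * s2 ^+ 2 = V + P2]. *)
pose s1 := Num.sqrt (1 + P1).
have s10 : 0 < s1 by rewrite sqrtr_gt0; lra.
have s1E : s1 ^+ 2 = 1 + P1 by rewrite sqr_sqrtr; lra.
pose v := Num.sqrt V.
have v0 : 0 < v by rewrite sqrtr_gt0.
have vV : v ^+ 2 = V by rewrite sqr_sqrtr // ltW.
have P2V : 0 <= P2 / V by rewrite divr_ge0 // ltW.
pose s2 := Num.sqrt (1 + P2 / V).
have s20 : 0 < s2 by rewrite sqrtr_gt0; lra.
have s2E : s2 ^+ 2 = 1 + P2 / V by rewrite sqr_sqrtr; lra.
have vE : v ^+ 2 = (a * s1) ^+ 2 + b ^+ 2.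
  by rewrite vV exprMn s1E bE /V; ring.
have ab : a ^+ 2 + b ^+ 2 = 1 by rewrite bE; ring.
pose A i y : R := ((d1 y == i)%:R * M1%:R + 1) / 2.
pose B j y : R := ((d2 y == j)%:R * M2%:R + 1) / 2.
have mA i : measurable_fun setT (A i).
  have h : measurable_fun setT (fun y => (d1 y == i)%:R : R).
    by apply: (@measurable_dec R _ _ n M1 id d1 i md1); exact: measurable_id.
  by rewrite /A; meas.
have mB j : measurable_fun setT (B j).
  have h : measurable_fun setT (fun y => (d2 y == j)%:R : R).
    by apply: (@measurable_dec R _ _ n M2 id d2 j md2); exact: measurable_id.
  by rewrite /B; meas.
have A0 i y : 0 < A i y by rewrite /A divr_gt0 // ltr_wpDl // mulr_ge0.
have B0 j y : 0 < B j y by rewrite /B divr_gt0 // ltr_wpDl // mulr_ge0.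
have sumdec M (d : n.-tuple R -> 'I_M) (y : n.-tuple R) :
    \sum_i ((d y == i)%:R * M%:R + 1) / 2 = M%:R :> R.
  rewrite -mulr_suml big_split /= -mulr_suml sumr_const card_ord.
  rewrite (bigD1 (d y)) //= eqxx big1 ?addr0 ?mul1r.
    by field.
  by move=> i; rewrite eq_sym => /negPf ->.
pose s i z z' := tadd (tscale a (tadd (x1 i) z)) (tscale b z').
pose xi j := tscale v^-1 (tadd (x2 j) (tscale (-1) mu)).
pose T i j z z' := A i (tadd (x1 i) z) * B j (tadd (x2 j) (s i z z')) *
  lratio s1 (x1 i) z * lratio s2 (xi j) (tscale v^-1 (s i z z')).
have sumT : (\sum_i \sum_j \int[G n]_z \int[G n]_z' (T i j z z')%:E = (M1%:R * M2%:R)%:E)%E.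
  apply: (@sum_tilted_density R n 'I_M1 'I_M2 A B x1 x2 mu a b s1 s2 v) => //.
  - by move=> i y; exact: ltW.
  - by move=> i y; exact: ltW.
  - by move=> y; exact: sumdec.
  - by move=> y; exact: sumdec.
pose K := n%:R * ((ln (1 + P1) + ln (1 + P2 / V)) / 2) + 2 * ln 2.
have lns (x y : R) : 0 < x -> x ^+ 2 = y -> ln x = ln y / 2.
  by move=> x0 <-; rewrite lnXn // -mulr_natl; field.
(* [1 + ln T <= T] with the logarithm expanded; the terms are placed so that both sides are sums of
   nonnegative functions, ready for integration. *)
have pt i j z z' :
  (d1 (tadd (x1 i) z) == i)%:R * ln M1%:R +
  (d2 (tadd (x2 j) (s i z z')) == j)%:R * ln M2%:R +
  (sqnorm z / 2 + sqnorm (s i z z') / (2 * V) + 1) <=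
  T i j z z' + (K + sqnorm (tadd (x1 i) z) / (2 * (1 + P1)) +
   sqnorm (tadd (tadd (x2 j) (tscale (-1) mu)) (s i z z')) / (2 * (V + P2))).
  set y1 := tadd (x1 i) z; set y2 := tadd (x2 j) (s i z z').
  have hA0 : 0 < A i y1 by exact: A0.
  have hB0 : 0 < B j y2 by exact: B0.
  have l1 : 0 < lratio s1 (x1 i) z by exact: lratio_gt0.
  have l2 : 0 < lratio s2 (xi j) (tscale v^-1 (s i z z')) by exact: lratio_gt0.
  have T0 : 0 < T i j z z'.
    exact: (mulr_gt0 (mulr_gt0 (mulr_gt0 hA0 hB0) l1) l2).
  have := expR_ge1Dx (ln (T i j z z')).
  have -> : ln (T i j z z') = ln (A i y1) + ln (B j y2) + ln (lratio s1 (x1 i) z) +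
      ln (lratio s2 (xi j) (tscale v^-1 (s i z z'))).
    rewrite -(lnM hA0 hB0) -(lnM (mulr_gt0 hA0 hB0) l1).
    by rewrite -(lnM (mulr_gt0 (mulr_gt0 hA0 hB0) l1) l2).
  rewrite !expRD !lnK ?posrE // !ln_lratio // -/(T i j z z').
  have hA := @ln_half_succ R (d1 y1 == i) M1%:R; rewrite ler1n M10 in hA.
  have hB := @ln_half_succ R (d2 y2 == j) M2%:R; rewrite ler1n M20 in hB.
  move: (hA isT) (hB isT); rewrite -/y1 -/y2 -/(A i y1) -/(B j y2).
  rewrite (lns s1 _ s10 s1E) (lns s2 _ s20 s2E) s1E s2E.
  have -> : tadd (xi j) (tscale v^-1 (s i z z')) =
    tscale v^-1 (tadd (tadd (x2 j) (tscale (-1) mu)) (s i z z')).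
    by tup; ring.
  rewrite !sqnorm_scale exprVn vV.
  have -> : V^-1 * sqnorm (tadd (tadd (x2 j) (tscale (-1) mu)) (s i z z')) / (2 * (1 + P2 / V)) =
    sqnorm (tadd (tadd (x2 j) (tscale (-1) mu)) (s i z z')) / (2 * (V + P2)).
    by field; rewrite !gt_eqF //; lra.
  have -> : V^-1 * sqnorm (s i z z') / 2 = sqnorm (s i z z') / (2 * V).
    by field; rewrite gt_eqF.
  rewrite /K; lra.
pose g1 i y := (d1 y == i)%:R * ln M1%:R : R.
pose g2 j y := (d2 y == j)%:R * ln M2%:R : R.
have mg1 i : measurable_fun setT (g1 i).
  apply: measurable_funM => //.
  by apply: (@measurable_dec R _ _ n M1 id d1 i md1); exact: measurable_id.
have mg2 j : measurable_fun setT (g2 j).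
  apply: measurable_funM => //.
  by apply: (@measurable_dec R _ _ n M2 id d2 j md2); exact: measurable_id.
have g10 i y : 0 <= g1 i y by rewrite mulr_ge0.
have g20 j y : 0 <= g2 j y by rewrite mulr_ge0.
have K0 : 0 <= K.
  have h1 : 0 <= ln (1 + P1) by rewrite ln_ge0 //; lra.
  have h2 : 0 <= ln (1 + P2 / V) by rewrite ln_ge0 //; lra.
  have h3 : 0 <= ln 2 :> R by rewrite ln_ge0 //; lra.
  by rewrite /K; pos.
have V20 : 0 < 2 * V by rewrite mulr_gt0.
have V2P : 0 < 2 * (V + P2) by rewrite mulr_gt0 // ltr_wpDr.
have P120 : 0 < 2 * (1 + P1) by rewrite mulr_gt0 // ltr_wpDr.
have int i j :
  (\int[G n]_z (g1 i (tadd (x1 i) z))%:E +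
   \int[G n]_z (g2 j (tadd (tadd (x2 j) (tscale a (x1 i))) z))%:E +
   (n%:R / 2 + (a ^+ 2 * sqnorm (x1 i) + n%:R) / (2 * V) + 1)%:E <=
   \int[G n]_z \int[G n]_z' (T i j z z')%:E +
   (K + (sqnorm (x1 i) + n%:R) / (2 * (1 + P1)) +
     (sqnorm (tadd (tadd (x2 j) (tscale (-1) mu)) (tscale a (x1 i))) + n%:R) / (2 * (V + P2)))%:E)%E.
  have mAi := mA i; have mBj := mB j; have mg1i := mg1 i; have mg2j := mg2 j.
  have ms : measurable_fun setT (fun p : n.-tuple R * n.-tuple R => s i p.1 p.2).
    by rewrite /s; meas.
  have mT : measurable_fun setT (fun p : n.-tuple R * n.-tuple R => T i j p.1 p.2).
    by rewrite /T; meas.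
  have T0 z z' : 0 <= T i j z z'.
    apply: ltW; exact: (mulr_gt0 (mulr_gt0 (mulr_gt0 (A0 _ _) (B0 _ _))
      (lratio_gt0 _ _ s10)) (lratio_gt0 _ _ s20)).
  have couple (g : n.-tuple R -> \bar R) :
      measurable_fun setT g -> (forall y, 0 <= g y)%E ->
      (\int[G n \x G n]_p g (s i p.1 p.2) = \int[G n]_u g (tadd (tscale a (x1 i)) u))%E.
    move=> mg g0; rewrite (@gauss_pair n (fun z z' => g (s i z z'))) //.
      by rewrite /s gauss_couple.
    exact: (measurableT_comp mg ms).
  have first_only (g : n.-tuple R -> \bar R) :
      measurable_fun setT g -> (forall y, 0 <= g y)%E ->
      (\int[G n \x G n]_p g p.1 = \int[G n]_u g u)%E.
    move=> mg g0; rewrite (@gauss_pair n (fun z z' => g z)) //; last meas.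
    by apply: eq_integral => z _; rewrite prob_integral_cst.
  rewrite -(@gauss_pair n (fun z z' => (T i j z z')%:E)); last 2 first.
  - by meas.
  - by move=> x y; rewrite lee_fin.
  have t1 := first_only (fun z => (g1 i (tadd (x1 i) z))%:E).
  have t2 := couple (fun y => (g2 j (tadd (x2 j) y))%:E).
  have t3 := first_only (fun z => (sqnorm z / 2)%:E).
  have t4 := couple (fun y => (sqnorm y / (2 * V))%:E).
  have t5 := first_only (fun z => (sqnorm (tadd (x1 i) z) / (2 * (1 + P1)))%:E).
  have t6 := couple (fun y => (sqnorm (tadd (tadd (x2 j) (tscale (-1) mu)) y) / (2 * (V + P2)))%:E).
  have L : (\int[G n \x G n]_p ((g1 i (tadd (x1 i) p.1))%:E +
      (g2 j (tadd (x2 j) (s i p.1 p.2)))%:E +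
      ((sqnorm p.1 / 2)%:E + (sqnorm (s i p.1 p.2) / (2 * V))%:E + 1)) <=
    \int[G n \x G n]_p ((T i j p.1 p.2)%:E + (K%:E + (sqnorm (tadd (x1 i) p.1) / (2 * (1 + P1)))%:E +
    (sqnorm (tadd (tadd (x2 j) (tscale (-1) mu)) (s i p.1 p.2)) / (2 * (V + P2)))%:E)))%E.
    apply: ge0_le_integral => //.
    - by move=> p _; rewrite lee_fin !addr_ge0 ?mulr_ge0 ?sqnorm_ge0 ?invr_ge0 // ltW.
    - meas.
    - meas.
    - by move=> p _; rewrite -!EFinD lee_fin; exact: pt.
  move: L; rewrite !ge0_integralD; try side.
  rewrite t1; try side. rewrite t2; try side. rewrite t3; try side.
  rewrite t4; try side. rewrite t5; try side. rewrite t6; try side.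
  rewrite !prob_integral_cst.
  have -> : (\int[G n]_u (g2 j (tadd (x2 j) (tadd (tscale a (x1 i)) u)))%:E =
    \int[G n]_u (g2 j (tadd (tadd (x2 j) (tscale a (x1 i))) u))%:E)%E.
    by apply: eq_integral => u _; rewrite tadd_assoc.
  have -> : (\int[G n]_u
      (sqnorm (tadd (tadd (x2 j) (tscale (-1) mu)) (tadd (tscale a (x1 i)) u)) / (2 * (V + P2)))%:E =
    \int[G n]_u
      (sqnorm (tadd (tadd (tadd (x2 j) (tscale (-1) mu)) (tscale a (x1 i))) u) / (2 * (V + P2)))%:E)%E.
    by apply: eq_integral => u _; rewrite tadd_assoc.
  by rewrite !gauss_sqnorm_div // gauss_sqnorm0_div // sqnorm_scale -!EFinD.
move: pt => _.
(* The energies are finite after integration, so they can be gathered on one side. *)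
pose e i j := K + (sqnorm (x1 i) + n%:R) / (2 * (1 + P1)) +
     (sqnorm (tadd (tadd (x2 j) (tscale (-1) mu)) (tscale a (x1 i))) + n%:R) / (2 * (V + P2)) -
     (n%:R / 2 + (a ^+ 2 * sqnorm (x1 i) + n%:R) / (2 * V) + 1).
have int' i j :
  (\int[G n]_z (g1 i (tadd (x1 i) z))%:E +
   \int[G n]_z (g2 j (tadd (tadd (x2 j) (tscale a (x1 i))) z))%:E <=
   \int[G n]_z \int[G n]_z' (T i j z z')%:E + (e i j)%:E)%E.
  by rewrite /e EFinB [leRHS]addeA leeBrDr //; exact: int.
apply: le_trans (_ : (\sum_i \sum_j (\int[G n]_z \int[G n]_z' (T i j z z')%:E + (e i j)%:E) <= _)%E).
  by apply: lee_sum => i _; apply: lee_sum => j _; exact: int'.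
under eq_bigr do rewrite big_split /=.
rewrite big_split /= sumT.
under eq_bigr do rewrite sumEFin.
rewrite sumEFin -EFinD lee_fin.
have cst (k : nat) (y : R) : \sum_(i < k) y = k%:R * y.
  by rewrite sumr_const card_ord mulr_natl.
(* The worst-noise step: the difference of the two sides is a positive multiple of
   [(1 - a^2) * (n * P1 - sqnorm (x1 i))], so the energy of user 1 contributes at most 0, its value
   at full power. *)
have eb i j : e i j <= K - 1 - n%:R / 2 +
     (sqnorm (tadd (tadd (x2 j) (tscale (-1) mu)) (tscale a (x1 i))) + n%:R) / (2 * (V + P2)).
  suff : (sqnorm (x1 i) + n%:R) / (2 * (1 + P1)) <= (a ^+ 2 * sqnorm (x1 i) + n%:R) / (2 * V).
    by rewrite /e; lra.
  rewrite ler_pdivrMr // mulrAC ler_pdivlMr //.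
  have : 0 <= (1 - a ^+ 2) * (n%:R * P1 - sqnorm (x1 i)).
    by apply: mulr_ge0; [lra | have := pw1 i; lra].
  by rewrite /V; lra.
(* By the choice of [mu], the mean energy is at most [n * (V + P2 - 1)]; adding the noise energy
   [n], the last fraction averages to at most [n / 2] and cancels. *)
have se : \sum_i \sum_j e i j <= M1%:R * M2%:R * (K - 1).
  apply: le_trans (_ : \sum_i \sum_j (K - 1 - n%:R / 2 +
     (sqnorm (tadd (tadd (x2 j) (tscale (-1) mu)) (tscale a (x1 i))) + n%:R) / (2 * (V + P2))) <= _).
    by apply: ler_sum => i _; apply: ler_sum => j _; exact: eb.
  have -> : \sum_(i < M1) \sum_(j < M2) (K - 1 - n%:R / 2 +
     (sqnorm (tadd (tadd (x2 j) (tscale (-1) mu)) (tscale a (x1 i))) + n%:R) / (2 * (V + P2))) =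
     M1%:R * M2%:R * (K - 1 - n%:R / 2 + n%:R / (2 * (V + P2))) +
     (\sum_i \sum_j sqnorm (tadd (tadd (x2 j) (tscale (-1) mu)) (tscale a (x1 i)))) / (2 * (V + P2)).
    have -> : M1%:R * M2%:R * (K - 1 - n%:R / 2 + n%:R / (2 * (V + P2))) =
      \sum_(i < M1) \sum_(j < M2) (K - 1 - n%:R / 2 + n%:R / (2 * (V + P2))).
      by rewrite !cst mulrA.
    rewrite mulr_suml -big_split /=; apply: eq_bigr => i _.
    rewrite mulr_suml -big_split /=; apply: eq_bigr => j _.
    by rewrite [in LHS]mulrDl; ring.
  apply: le_trans (_ : M1%:R * M2%:R * (K - 1 - n%:R / 2 + n%:R / (2 * (V + P2))) +
     (M1%:R * M2%:R * (n%:R * (P2 + a ^+ 2 * P1))) / (2 * (V + P2)) <= _).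
    by rewrite lerD2l ler_pM2r ?invr_gt0.
  rewrite le_eqVlt; apply/orP; left; apply/eqP; rewrite -/V (_ : P2 + a ^+ 2 * P1 = V + P2 - 1); last by rewrite /V; ring.
  by field; rewrite gt_eqF // ltr_wpDr.
rewrite -/K; lra.
Qed.

End z_channel_converse.

(** * Probabilities of boolean events as real numbers *)

Section probability.
Variable R : realType.
Notation G := (gauss R).

Definition measurable_bool d (T : measurableType d) (A : T -> bool) :=
  measurable_fun setT (fun x => (A x)%:R : R).

Local Notation mbool := measurable_bool.

Lemma mboolN d (T : measurableType d) (A : T -> bool) : mbool A -> mbool (fun x => ~~ A x).
Proof.
move=> mA; rewrite /measurable_bool; have -> : (fun x => (~~ A x)%:R : R) = (fun x => 1 - (A x)%:R).
  by apply/funext => x; case: (A x); rewrite ?subrr ?subr0.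
by rewrite /measurable_bool in mA; meas.
Qed.

Lemma mboolU d (T : measurableType d) (A B : T -> bool) :
  mbool A -> mbool B -> mbool (fun x => A x || B x).
Proof.
move=> mA mB; rewrite /measurable_bool.
have -> : (fun x => (A x || B x)%:R : R) = (fun x => (A x)%:R + (B x)%:R - (A x)%:R * (B x)%:R).
  by apply/funext => x; case: (A x); case: (B x); rewrite /=; ring.
by rewrite /measurable_bool in mA mB; meas.
Qed.

Lemma mbool_comp d d' (T : measurableType d) (U : measurableType d') (A : T -> bool) (f : U -> T) :
  mbool A -> measurable_fun setT f -> mbool (fun x => A (f x)).
Proof. by move=> mA mf; exact: (measurableT_comp mA mf). Qed.

Lemma mbool_dec n M (d : n.-tuple R -> 'I_M) (m : 'I_M) :
  (forall m, measurable (d @^-1` [set m])) -> mbool (fun y => d y == m).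
Proof. by move=> md; apply: (@measurable_dec R _ _ n M id d m md); exact: measurable_id. Qed.

Definition pr n (A : n.-tuple R -> bool) : R := fine (\int[G n]_z ((A z)%:R : R)%:E).

Lemma prE n (A : n.-tuple R -> bool) : mbool A ->
  (\int[G n]_z ((A z)%:R : R)%:E = (pr A)%:E)%E.
Proof.
move=> mA; rewrite /pr fineK // ge0_fin_numE; last first.
  by apply: integral_ge0 => z _; rewrite lee_fin.
apply: le_lt_trans (ltry 1).
rewrite -(prob_integral_cst (G n) 1%:E).
rewrite /measurable_bool in mA; apply: ge0_le_integral; try side.
by move=> z _; rewrite lee_fin; case: (A z).
Qed.

Lemma pr_ge0 n (A : n.-tuple R -> bool) : 0 <= pr A.
Proof. by rewrite fine_ge0 // integral_ge0 // => z _; rewrite lee_fin. Qed.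

Lemma prN n (A : n.-tuple R -> bool) : mbool A -> pr (fun z => ~~ A z) = 1 - pr A.
Proof.
move=> mA; have mA' := mA; rewrite /measurable_bool in mA'.
have mN := mboolN mA; have mN' := mN; rewrite /measurable_bool in mN'.
have : ((pr (fun z => ~~ A z))%:E + (pr A)%:E = 1)%E.
  rewrite -!prE // -ge0_integralD; try side.
  rewrite -[RHS](prob_integral_cst (G n)); apply: eq_integral => z _.
  by rewrite -EFinD; congr EFin; case: (A z); rewrite /= ?add0r ?addr0.
by rewrite -EFinD => -[] h; lra.
Qed.

Lemma eq_pr n (A B : n.-tuple R -> bool) : A =1 B -> pr A = pr B.
Proof. by move=> /funext ->. Qed.

Lemma le_pr n (A B : n.-tuple R -> bool) : mbool A -> mbool B ->
  (forall z, A z -> B z) -> pr A <= pr B.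
Proof.
move=> mA mB AB; rewrite -lee_fin -!prE //.
rewrite /measurable_bool in mA mB; apply: ge0_le_integral; try side.
by move=> z _; rewrite lee_fin ler_nat; move: (AB z); case: (A z) => // ->.
Qed.

Lemma prU n (A B : n.-tuple R -> bool) : mbool A -> mbool B ->
  pr (fun z => A z || B z) <= pr A + pr B.
Proof.
move=> mA mB; rewrite -lee_fin EFinD -!prE //; last exact: mboolU.
have mAB := mboolU mA mB.
rewrite /measurable_bool in mA mB mAB; rewrite -ge0_integralD; try side.
apply: ge0_le_integral; try side.
by move=> z _; rewrite -EFinD lee_fin; case: (A z); case: (B z); rewrite /=; lra.
Qed.

Lemma zic_converse_pr n M1 M2 (a P1 P2 : R)
    (x1 : 'I_M1 -> n.-tuple R) (x2 : 'I_M2 -> n.-tuple R)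
    (d1 : n.-tuple R -> 'I_M1) (d2 : n.-tuple R -> 'I_M2) (e1 e2 : R) :
  (0 < M1)%N -> (0 < M2)%N -> a ^+ 2 < 1 -> 0 <= P1 -> 0 <= P2 ->
  (forall i, power_ok P1 (x1 i)) -> (forall j, power_ok P2 (x2 j)) ->
  (forall m, measurable (d1 @^-1` [set m])) -> (forall m, measurable (d2 @^-1` [set m])) ->
  \sum_i pr (fun z => d1 (tadd (x1 i) z) != i) <= M1%:R * e1 ->
  \sum_i \sum_j pr (fun z => d2 (tadd (tadd (x2 j) (tscale a (x1 i))) z) != j)
    <= M1%:R * M2%:R * e2 ->
  (1 - e1) * ln M1%:R + (1 - e2) * ln M2%:R
  <= n%:R * ((ln (1 + P1) + ln (1 + P2 / (1 + a ^+ 2 * P1))) / 2) + 2 * ln 2.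
Proof.
move=> M10 M20 a1 P10 P20 pw1 pw2 md1 md2 h1 h2.
have lM1 : 0 <= ln M1%:R :> R by rewrite ln_ge0 // ler1n.
have lM2 : 0 <= ln M2%:R :> R by rewrite ln_ge0 // ler1n.
have := zic_converse M10 M20 a1 P10 P20 pw1 pw2 md1 md2.
set C := n%:R * _ + _.
have mb1 i : mbool (fun z => d1 (tadd (x1 i) z) == i).
  apply: (@mbool_comp _ _ _ _ (fun y => d1 y == i) (fun z => tadd (x1 i) z)); last meas.
  exact: mbool_dec.
have mb2 i j : mbool (fun z => d2 (tadd (tadd (x2 j) (tscale a (x1 i))) z) == j).
  apply: (@mbool_comp _ _ _ _ (fun y => d2 y == j)
    (fun z => tadd (tadd (x2 j) (tscale a (x1 i))) z)); last meas.
  exact: mbool_dec.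
have e i j :
  (\int[G n]_z ((d1 (tadd (x1 i) z) == i)%:R * ln M1%:R)%:E +
   \int[G n]_z ((d2 (tadd (tadd (x2 j) (tscale a (x1 i))) z) == j)%:R * ln M2%:R)%:E =
   ((1 - pr (fun z => d1 (tadd (x1 i) z) != i)) * ln M1%:R +
    (1 - pr (fun z => d2 (tadd (tadd (x2 j) (tscale a (x1 i))) z) != j)) * ln M2%:R)%:E)%E.
  rewrite prN // prN // !subKr EFinD !EFinM -!prE //.
  have m1 := mb1 i; have m2 := mb2 i j; rewrite /measurable_bool in m1 m2.
  under eq_integral do rewrite EFinM.
  under [X in (_ + X)%E = _]eq_integral do rewrite EFinM.
  rewrite ge0_integralZr; try side.
  by rewrite ge0_integralZr; try side.
under eq_bigr do under eq_bigr do rewrite e.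
under eq_bigr do rewrite sumEFin.
rewrite sumEFin lee_fin.
set q1 := fun i => pr (fun z => d1 (tadd (x1 i) z) != i).
set q2 := fun i j => pr (fun z => d2 (tadd (tadd (x2 j) (tscale a (x1 i))) z) != j).
have cst (k : nat) (y : R) : \sum_(i < k) y = k%:R * y.
  by rewrite sumr_const card_ord mulr_natl.
have -> : \sum_i \sum_j ((1 - q1 i) * ln M1%:R + (1 - q2 i j) * ln M2%:R) =
   M1%:R * M2%:R * (ln M1%:R + ln M2%:R) - M2%:R * ln M1%:R * (\sum_i q1 i)
   - ln M2%:R * (\sum_i \sum_j q2 i j).
  have -> : M1%:R * M2%:R * (ln M1%:R + ln M2%:R) =
    \sum_(i < M1) \sum_(j < M2) (ln M1%:R + ln M2%:R) :> R by rewrite !cst mulrA.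
  have -> : M2%:R * ln M1%:R * (\sum_i q1 i) = \sum_i \sum_(j < M2) (ln M1%:R * q1 i).
    by rewrite mulr_sumr; apply: eq_bigr => i _; rewrite cst mulrA.
  rewrite mulr_sumr -!sumrB; apply: eq_bigr => i _.
  by rewrite mulr_sumr -!sumrB; apply: eq_bigr => j _; ring.
rewrite -/(q1 _) in h1.
move=> H.
have M1r : 0 < M1%:R :> R by rewrite ltr0n.
have M2r : 0 < M2%:R :> R by rewrite ltr0n.
have k1 : M2%:R * ln M1%:R * (\sum_i q1 i) <= M2%:R * ln M1%:R * (M1%:R * e1).
  by rewrite ler_wpM2l // mulr_ge0 // ltW.
have k2 : ln M2%:R * (\sum_i \sum_j q2 i j) <= ln M2%:R * (M1%:R * M2%:R * e2).
  by rewrite ler_wpM2l.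
rewrite -(ler_pM2l (mulr_gt0 M1r M2r)); lra.
Qed.

End probability.

(** * Error probability of a code in terms of its receivers *)

Section perr.
Variable R : realType.
Notation G := (gauss R).
Notation mbool := (measurable_bool R).

Lemma pr_le1 n (A : n.-tuple R -> bool) : mbool A -> pr A <= 1.
Proof. by move=> mA; have := pr_ge0 (fun z => ~~ A z); rewrite prN //; lra. Qed.

Lemma gauss_int_affine n (A : n.-tuple R -> bool) (u v : R) : mbool A -> 0 <= u -> 0 <= v ->
  gauss_int (fun z => (u + v * (A z)%:R)%:E) = (u + v * pr A)%:E.
Proof.
move=> mA u0 v0; have mA' := mA; rewrite /measurable_bool in mA'.
rewrite gauss_intE; try side.
under eq_integral do rewrite EFinD EFinM.
rewrite ge0_integralD; try side.
rewrite prob_integral_cst ge0_integralZl; try side.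
by rewrite prE // -EFinM -EFinD.
Qed.

(* The three noises are independent, so the probability of a union of three events, each
   about a single noise, has a product form. *)
Lemma gauss_int_or3 n (A B C : n.-tuple R -> bool) : mbool A -> mbool B -> mbool C ->
  gauss_int (fun z1 => gauss_int (fun z2 => gauss_int (fun z3 =>
    (([|| A z1, B z2 | C z3])%:R : R)%:E))) =
  (1 - (1 - pr A) * (1 - pr B) * (1 - pr C))%:E.
Proof.
move=> mA mB mC.
have := (pr_ge0 A, pr_ge0 B, pr_ge0 C) => -[[a0 b0] c0].
have := (pr_le1 mA, pr_le1 mB, pr_le1 mC) => -[[a1 b1] c1].
have e3 z1 z2 : gauss_int (fun z3 => (([|| A z1, B z2 | C z3])%:R : R)%:E) =
   ((A z1 || B z2)%:R + (1 - (A z1 || B z2)%:R) * pr C)%:E.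
  rewrite -gauss_int_affine //; last by case: (_ || _); rewrite /= ?subrr ?subr0.
  congr gauss_int; apply/funext => z3; congr EFin.
  by case: (A z1); case: (B z2); case: (C z3); rewrite /=; ring.
have e2 z1 : gauss_int (fun z2 => gauss_int (fun z3 => (([|| A z1, B z2 | C z3])%:R : R)%:E)) =
   ((A z1)%:R + (1 - (A z1)%:R) * (1 - (1 - pr B) * (1 - pr C)))%:E.
  transitivity (gauss_int (fun z2 => ((A z1)%:R + (1 - (A z1)%:R) * pr C +
     ((1 - (A z1)%:R) * (1 - pr C)) * (B z2)%:R)%:E)).
    congr gauss_int; apply/funext => z2; rewrite e3; congr EFin.
    by case: (A z1); case: (B z2); rewrite /=; ring.
  rewrite gauss_int_affine //.
  - by congr EFin; ring.
  - by case: (A z1); rewrite /=; lra.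
  - by case: (A z1); rewrite /=; lra.
transitivity (gauss_int (fun z1 => (1 - (1 - pr B) * (1 - pr C) +
     ((1 - pr B) * (1 - pr C)) * (A z1)%:R)%:E)).
  congr gauss_int; apply/funext => z1; rewrite e2; congr EFin.
  by case: (A z1); rewrite /=; ring.
have bc0 : 0 <= (1 - pr B) * (1 - pr C) by apply: mulr_ge0; lra.
have bc1 : 0 <= 1 - (1 - pr B) * (1 - pr C).
  have : 0 <= (1 - pr B) * pr C by apply: mulr_ge0; lra.
  by lra.
by rewrite gauss_int_affine //; congr EFin; ring.
Qed.

Variables (n M1 M2 M3 : nat) (a1 a2 : R) (c : Defs.code R n M1 M2 M3).

Definition err1 w1 : R := pr (fun z => dec1 c (tadd (enc1 c w1) z) != w1).
Definition err2 w1 w2 : R :=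
  pr (fun z => dec2 c (tadd (tadd (enc2 c w2) (tscale a1 (enc1 c w1))) z) != w2).
Definition err3 w2 w3 : R :=
  pr (fun z => dec3 c (tadd (tadd (enc3 c w3) (tscale a2 (enc2 c w2))) z) != w3).

Lemma mbool_dec_shift M (d : n.-tuple R -> 'I_M) (x : n.-tuple R) m :
  (forall m, measurable (d @^-1` [set m])) -> mbool (fun z => d (tadd x z) != m).
Proof.
move=> md; apply: mboolN.
apply: (@mbool_comp R _ _ _ _ (fun y => d y == m) (fun z => tadd x z)); last meas.
exact: mbool_dec.
Qed.

Lemma perr_msgE P1 P2 P3 w1 w2 w3 : admissible P1 P2 P3 c ->
  perr_msg a1 a2 c w1 w2 w3 =
  (1 - (1 - err1 w1) * (1 - err2 w1 w2) * (1 - err3 w2 w3))%:E.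
Proof.
move=> [_ [m1 m2 m3]]; rewrite /perr_msg /err_event gauss_int_or3 //; exact: mbool_dec_shift.
Qed.

Lemma err_bounds P1 P2 P3 w1 w2 w3 : admissible P1 P2 P3 c ->
  [/\ 0 <= err1 w1 <= 1, 0 <= err2 w1 w2 <= 1 & 0 <= err3 w2 w3 <= 1].
Proof.
move=> [_ [m1 m2 m3]].
by split; apply/andP; split; rewrite ?pr_ge0 // pr_le1 //; exact: mbool_dec_shift.
Qed.

(** A failure of any one receiver is a failure of the code, so each receiver's average error is at
    most [e]. Each inequality is first multiplied by the number of messages on which that error does
    not depend. *)
Lemma perr_le P1 P2 P3 (e : R) : admissible P1 P2 P3 c -> (0 < M1)%N -> (0 < M2)%N -> (0 < M3)%N ->
  (perr a1 a2 c <= e%:E)%E ->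
  [/\ \sum_w1 err1 w1 <= M1%:R * e,
      \sum_w1 \sum_w2 err2 w1 w2 <= M1%:R * M2%:R * e &
      \sum_w2 \sum_w3 err3 w2 w3 <= M2%:R * M3%:R * e].
Proof.
move=> ad M10 M20 M30; rewrite /perr.
under eq_bigr do under eq_bigr do under eq_bigr do rewrite (perr_msgE _ _ _ ad).
under eq_bigr do under eq_bigr do rewrite sumEFin.
under eq_bigr do rewrite sumEFin.
rewrite sumEFin -EFinM lee_fin ler_pdivrMl ?ltr0n ?muln_gt0 ?M10 ?M20 // => h.
set f := fun w1 w2 w3 => 1 - (1 - err1 w1) * (1 - err2 w1 w2) * (1 - err3 w2 w3).
have bnd w1 w2 w3 := err_bounds w1 w2 w3 ad.
have f1 w1 w2 w3 : err1 w1 <= f w1 w2 w3 /\ err2 w1 w2 <= f w1 w2 w3 /\ err3 w2 w3 <= f w1 w2 w3.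
  have [/andP[x0 x1] /andP[y0 y1] /andP[z0 z1]] := bnd w1 w2 w3; rewrite /f.
  set x := err1 w1 in x0 x1 *; set y := err2 w1 w2 in y0 y1 *; set z := err3 w2 w3 in z0 z1 *.
  have hy : (1 - x) * (1 - y) * (1 - z) <= (1 - x) * (1 - y).
    by rewrite ler_piMr ?mulr_ge0 //; lra.
  have hz : (1 - x) * (1 - y) * (1 - z) <= 1 - z.
    have hxy : (1 - x) * (1 - y) <= 1 by rewrite mulr_ile1 //; lra.
    by rewrite ler_piMl //; lra.
  have hx1 : (1 - x) * (1 - y) <= 1 - x by rewrite ler_piMr //; lra.
  have hy1 : (1 - x) * (1 - y) <= 1 - y by rewrite ler_piMl //; lra.
  by split; [|split]; lra.
have cst (k : nat) (y : R) : \sum_(i < k) y = k%:R * y.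
  by rewrite sumr_const card_ord mulr_natl.
have M1r : 0 < M1%:R :> R by rewrite ltr0n.
have M2r : 0 < M2%:R :> R by rewrite ltr0n.
have M3r : 0 < M3%:R :> R by rewrite ltr0n.
rewrite !natrM in h.
split.
- rewrite -(ler_pM2l (mulr_gt0 M2r M3r)).
  apply: le_trans (_ : M1%:R * M2%:R * M3%:R * e <= _); last by rewrite le_eqVlt; apply/orP; left; apply/eqP; ring.
  apply: le_trans h; rewrite mulr_sumr; apply: ler_sum => w1 _.
  rewrite -mulrA -!cst; apply: ler_sum => w2 _; apply: ler_sum => w3 _.
  by case: (f1 w1 w2 w3).
- rewrite -(ler_pM2l M3r).
  apply: le_trans (_ : M1%:R * M2%:R * M3%:R * e <= _); last by rewrite le_eqVlt; apply/orP; left; apply/eqP; ring.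
  apply: le_trans h; rewrite mulr_sumr; apply: ler_sum => w1 _.
  rewrite mulr_sumr; apply: ler_sum => w2 _; rewrite -cst; apply: ler_sum => w3 _.
  by case: (f1 w1 w2 w3) => _ [].
- rewrite -(ler_pM2l M1r).
  apply: le_trans (_ : M1%:R * M2%:R * M3%:R * e <= _); last by rewrite le_eqVlt; apply/orP; left; apply/eqP; ring.
  apply: le_trans h; rewrite -cst; apply: ler_sum => w1 _.
  apply: ler_sum => w2 _; apply: ler_sum => w3 _.
  by case: (f1 w1 w2 w3) => _ [].
Qed.

End perr.

(** * Upper bound on the sum rate *)

Section converse.
Variable R : realType.
Notation G := (gauss R).

(* [rho] is a rate in nats; [e] is the error probability. *)
Lemma rate_limit (rho C D : R) : 0 <= C ->
  (forall e : R, 0 < e -> e < 1 -> exists N, forall n, (N <= n)%N ->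
    (1 - e) * (n%:R * rho) <= n%:R * C + D) -> rho <= C.
Proof.
move=> C0 h; rewrite leNgt; apply/negP => Cr.
have r0 : 0 < rho by exact: le_lt_trans Cr.
(* Chosen so that [(1 - e) * rho] is the midpoint of [rho] and [C]; any [n] above
   [2 * D / (rho - C)] then gives a contradiction. *)
pose e := (rho - C) / (2 * rho).
have e0 : 0 < e by rewrite divr_gt0 ?mulr_gt0 // subr_gt0.
have e1 : e < 1 by rewrite ltr_pdivrMr ?mulr_gt0 //; lra.
have [N hN] := h e e0 e1.
pose n := maxn N (Num.truncn (2 * D / (rho - C))).+1.
have := hN n (leq_maxl _ _).
have nb : 2 * D / (rho - C) < n%:R.
  apply: lt_le_trans (truncnS_gt _) _; rewrite ler_nat; exact: leq_maxr.
rewrite ltr_pdivrMr ?subr_gt0 // in nb.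
have -> : (1 - e) * (n%:R * rho) = n%:R * (rho + C) / 2.
  by rewrite /e; field; rewrite gt_eqF.
lra.
Qed.

Lemma ln_card (M : nat) (x : R) : 2 `^ x <= M%:R -> (0 < M)%N /\ x * ln 2 <= ln M%:R.
Proof.
move=> h; have p : 0 < 2 `^ x :> R by rewrite powR_gt0.
have M0 : 0 < M%:R :> R by exact: lt_le_trans h.
split; first by rewrite -(ltr0n R).
by rewrite -ln_powR ler_ln ?posrE.
Qed.

Lemma achievable_le (a1 a2 P1 P2 P3 r1 r2 r3 : R) :
  0 < P1 -> 0 < P2 -> 0 < P3 -> a1 ^+ 2 < 1 ->
  achievable a1 a2 P1 P2 P3 r1 r2 r3 ->
  r1 + r2 + r3 <= Cfun P1 + Cfun (P2 / (1 + a1 ^+ 2 * P1)) + Cfun P3.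
Proof.
move=> P10 P20 P30 a11 [r10 r20 r30 [M1 [M2 [M3 [c [ad rt er]]]]]].
have ln20 : 0 < ln 2 :> R by rewrite ln_gt0 // ltr1n.
have V0 : 0 < 1 + a1 ^+ 2 * P1 by rewrite ltr_pwDl // mulr_ge0 ?sqr_ge0 // ltW.
have lC (x : R) : 0 <= x -> 0 <= ln (1 + x) by move=> x0; rewrite ln_ge0 //; lra.
have P2V : 0 <= P2 / (1 + a1 ^+ 2 * P1) by rewrite divr_ge0 // ltW.
have b12 : (r1 + r2) * ln 2 <= (ln (1 + P1) + ln (1 + P2 / (1 + a1 ^+ 2 * P1))) / 2.
  apply: (@rate_limit _ _ (2 * ln 2)).
    by rewrite divr_ge0 // addr_ge0 // lC // ltW.
  move=> e e0 e1; have [N hN] := er e e0; exists N => n nN.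
  have [h1 h2 h3] := rt n.
  have [m1 l1] := ln_card h1; have [m2 l2] := ln_card h2; have [m3 l3] := ln_card h3.
  have [q1 q2 q3] := perr_le (ad n) m1 m2 m3 (hN n nN).
  have [[p1 p2 p3] [d1 d2 d3]] := ad n.
  have := @zic_converse_pr R n (M1 n) (M2 n) a1 P1 P2 (enc1 (c n)) (enc2 (c n))
    (dec1 (c n)) (dec2 (c n)) e e m1 m2 a11 (ltW P10) (ltW P20) p1 p2 d1 d2 q1 q2.
  apply: le_trans.
  rewrite -mulrDr; apply: ler_wpM2l; first lra.
  have -> : n%:R * ((r1 + r2) * ln 2) = n%:R * r1 * ln 2 + n%:R * r2 * ln 2 by ring.
  exact: lerD.
have b3 : r3 * ln 2 <= ln (1 + P3) / 2.
  apply: (@rate_limit _ _ (2 * ln 2)).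
    by rewrite divr_ge0 // lC // ltW.
  move=> e e0 e1; have [N hN] := er e e0; exists N => n nN.
  have [h1 h2 h3] := rt n.
  have [m1 l1] := ln_card h1; have [m2 l2] := ln_card h2; have [m3 l3] := ln_card h3.
  have [q1 q2 q3] := perr_le (ad n) m1 m2 m3 (hN n nN).
  have [[p1 p2 p3] [d1 d2 d3]] := ad n.
  have M2r : 0 < (M2 n)%:R :> R by rewrite ltr0n.
  pose ew w2 := (\sum_w3 err3 a2 (c n) w2 w3) / (M3 n)%:R.
  have M3N : (M3 n)%:R != 0 :> R by rewrite pnatr_eq0 -lt0n.
  (* For a fixed word of user 2 the interference is known, and its shift is absorbed into the
     decoder. The point-to-point converse is the Z-channel converse with [a = 0] and a second user
     with one message and the zero codeword. *)
  have each w2 : (1 - ew w2) * ln (M3 n)%:R <= n%:R * (ln (1 + P3) / 2) + 2 * ln 2.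
    pose z := [tuple (0:R) | _ < n].
    have pz (j : 'I_1) : power_ok 0 z.
      by rewrite /power_ok mulr0 big1 // => i _; rewrite tnth_mktuple expr0n.
    have mshift m : measurable ((fun y => dec3 (c n) (tadd y (tscale a2 (enc2 (c n) w2)))) @^-1` [set m]).
      have -> : (fun y => dec3 (c n) (tadd y (tscale a2 (enc2 (c n) w2)))) @^-1` [set m] =
        setT `&` (fun y => tadd y (tscale a2 (enc2 (c n) w2))) @^-1` (dec3 (c n) @^-1` [set m]).
        by rewrite setTI.
      by apply: measurable_tadd => //; exact: measurable_cst.
    have mc (m : 'I_1) : measurable ((fun _ : n.-tuple R => ord0 : 'I_1) @^-1` [set m]).
      rewrite (_ : _ @^-1` _ = setT) //; apply/seteqP; split => // x _ /=.
      by rewrite (ord1 m).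
    have s1 : \sum_i pr (fun y => dec3 (c n) (tadd (tadd (enc3 (c n) i) y) (tscale a2 (enc2 (c n) w2))) != i)
        <= (M3 n)%:R * ew w2.
      rewrite /ew mulrCA mulfV // mulr1; apply: ler_sum => w3 _; rewrite /err3.
      rewrite le_eqVlt; apply/orP; left; apply/eqP; apply: eq_pr => y /=.
      congr (dec3 _ _ != _); apply: eq_from_tnth => i; rewrite !tnth_mktuple; ring.
    have s2 : \sum_(i < M3 n) \sum_(j < 1) pr (fun y : n.-tuple R => (ord0 : 'I_1) != j)
        <= (M3 n)%:R * 1%:R * (0 : R).
      rewrite mulr0 big1 // => i _; rewrite big1 // => j _; rewrite (ord1 j) /=.
      by rewrite /pr integral0.
    have := @zic_converse_pr R n (M3 n) 1 0 P3 0 (enc3 (c n)) (fun _ => z)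
      (fun y => dec3 (c n) (tadd y (tscale a2 (enc2 (c n) w2)))) (fun _ => ord0)
      (ew w2) 0 m3 isT _ (ltW P30) (lexx 0) p3 pz mshift mc s1 s2.
    rewrite expr0n /= ltr01 !(mul0r, addr0, ln1, mulr0).
    by apply.
  have : \sum_w2 ((1 - ew w2) * ln (M3 n)%:R) <=
      \sum_(w2 < M2 n) (n%:R * (ln (1 + P3) / 2) + 2 * ln 2).
    by apply: ler_sum => w2 _; exact: each.
  rewrite [leRHS]sumr_const card_ord -[leRHS]mulr_natl -mulr_suml sumrB sumr_const card_ord.
  have hs : \sum_w2 ew w2 <= (M2 n)%:R * e.
    by rewrite /ew -mulr_suml ler_pdivrMr ?ltr0n // mulrAC.
  have lM3 : 0 <= ln (M3 n)%:R :> R by rewrite ln_ge0 // ler1n.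
  move=> H.
  have H2 : (M2 n)%:R * ((1 - e) * ln (M3 n)%:R) <= ((M2 n)%:R - \sum_w2 ew w2) * ln (M3 n)%:R.
    rewrite mulrA; apply: ler_wpM2r => //; lra.
  have := le_trans H2 H; rewrite ler_pM2l //; apply: le_trans.
  by apply: ler_wpM2l; [lra | rewrite mulrA].
rewrite /Cfun /log2 -(ler_pM2r ln20) !mulrDl.
have -> (x : R) : 2^-1 * (x / ln 2) * ln 2 = x / 2 by field; rewrite gt_eqF.
have -> (x : R) : 2^-1 * (x / ln 2) * ln 2 = x / 2 by field; rewrite gt_eqF.
have -> (x : R) : 2^-1 * (x / ln 2) * ln 2 = x / 2 by field; rewrite gt_eqF.
move: b12; rewrite !mulrDl; lra.
Qed.

End converse.

(** * Achievability *)

Section tails.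
Variable R : realType.
Notation G := (gauss R).
Notation mbool := (measurable_bool R).

Lemma mbool_le d (T : measurableType d) (f g : T -> R) :
  measurable_fun setT f -> measurable_fun setT g -> mbool (fun x => f x <= g x).
Proof.
move=> mf mg; have mb := measurable_fun_ler mf mg.
exact: (measurableT_comp (f := fun b : bool => b%:R : R)).
Qed.

Lemma mbool_lt d (T : measurableType d) (f g : T -> R) :
  measurable_fun setT f -> measurable_fun setT g -> mbool (fun x => f x < g x).
Proof.
move=> mf mg; have mb := measurable_fun_ltr mf mg.
exact: (measurableT_comp (f := fun b : bool => b%:R : R)).
Qed.

(* Chernoff bound for the chi-square law, optimised over the exponent. *)
Definition tail_base (s : R) : R := Num.sqrt s * expR (- ((s - 1) / 2)).

Lemma tail_base_ge0 (s : R) : 0 <= tail_base s.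
Proof. by rewrite mulr_ge0 ?sqrtr_ge0 ?expR_ge0. Qed.

(** After squaring, this is the strict inequality [s < expR (s - 1)] for [s] different from 1. *)
Lemma tail_base_lt1 (s : R) : 0 < s -> s != 1 -> 0 < tail_base s < 1.
Proof.
move=> s0 s1; rewrite /tail_base mulr_gt0 ?sqrtr_gt0 ?expR_gt0 //=.
rewrite expRN ltr_pdivrMr ?expR_gt0 // mul1r.
rewrite -(ltr_pXn2r (ltn0Sn 1)) ?nnegrE ?sqrtr_ge0 ?expR_ge0 //.
rewrite sqr_sqrtr ?ltW // -expRM_natl.
have -> : 2%:R * ((s - 1) / 2) = s - 1 by field.
have : 1 + (s - 1) < expR (s - 1) by apply: expR_gt1Dx; rewrite subr_eq0.
lra.
Qed.

(** On [A], the number [tail_base s ^+ n] times the ratio of N(0, s I) to N(0, I) is at least 1, and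
    that ratio has integral 1. The sign of [1 - s^-1] makes this an upper tail for [s > 1] and a
    lower tail for [s < 1]. *)
Lemma pr_tail n (s : R) (A : n.-tuple R -> bool) : 0 < s -> mbool A ->
  (forall z, A z -> n%:R * (s - 1) <= sqnorm z * (1 - s^-1)) ->
  pr A <= tail_base s ^+ n.
Proof.
move=> s0 mA h; rewrite -lee_fin -prE //.
have mA' := mA; rewrite /measurable_bool in mA'.
pose o := [tuple (0:R) | _ < n].
have q0 : 0 < Num.sqrt s by rewrite sqrtr_gt0.
have t0 : 0 <= tail_base s by rewrite /tail_base mulr_ge0 ?sqrtr_ge0 ?expR_ge0.
have -> : ((tail_base s ^+ n)%:E = \int[G n]_z ((tail_base s ^+ n)%:E * (lratio (Num.sqrt s) o z)%:E))%E.
  rewrite ge0_integralZl; try side.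
  by rewrite integral_lratio // mule1.
apply: ge0_le_integral; try side.
move=> z _; rewrite -EFinM lee_fin.
case: (boolP (A z)) => [Az|_]; last by rewrite mulr_ge0 ?exprn_ge0 // ltW // lratio_gt0.
rewrite /tail_base /lratio exprMn -expRM_natl mulrACA mulfV ?mul1r; last first.
  by rewrite expf_neq0 // gt_eqF.
rewrite -expRD -[leLHS]expR0 ler_expR sqr_sqrtr; last exact: ltW.
have -> : tadd o z = z by tup; rewrite add0r.
have -> : sqnorm z / 2 - sqnorm z / (2 * s) = sqnorm z * (1 - s^-1) / 2.
  by field; rewrite gt_eqF.
have := h z Az. lra.
Qed.

Lemma pr_sqnorm_ge n (s : R) : 1 < s -> pr (fun z : n.-tuple R => n%:R * s <= sqnorm z) <= tail_base s ^+ n.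
Proof.
move=> s1; have s0 : 0 < s by lra.
apply: pr_tail => //.
  by apply: mbool_le; [exact: measurable_cst | exact: measurable_sqnorm_id].
move=> z; rewrite -[s - 1](_ : s * (1 - s^-1) = _); last by field; rewrite gt_eqF.
by rewrite mulrA => h; rewrite ler_wpM2r // subr_ge0 invf_le1 ?ltW.
Qed.

Lemma pr_sqnorm_le n (s : R) : 0 < s -> s < 1 ->
  pr (fun z : n.-tuple R => sqnorm z <= n%:R * s) <= tail_base s ^+ n.
Proof.
move=> s0 s1; apply: pr_tail => //.
  by apply: mbool_le; [exact: measurable_sqnorm_id | exact: measurable_cst].
move=> z; rewrite -[s - 1](_ : s * (1 - s^-1) = _); last by field; rewrite gt_eqF.
by rewrite mulrA => h; rewrite ler_wnM2r // subr_le0 invf_ge1 ?ltW.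
Qed.

(** The probabilistic method: a cost with small mean is small somewhere. *)
Lemma exists_lt_integral n (h : n.-tuple R -> R) (e : R) :
  measurable_fun setT h -> (forall u, 0 <= h u) ->
  (\int[G n]_u (h u)%:E < e%:E)%E -> exists u, h u < e.
Proof.
move=> mh h0 H; apply: contrapT => /forallNP N.
have : (e%:E <= \int[G n]_u (h u)%:E)%E.
  have [e0|e0] := leP 0 e; last first.
    apply: le_trans (_ : 0 <= _)%E; first by rewrite lee_fin ltW.
    by apply: integral_ge0 => u _; rewrite lee_fin.
  rewrite -[leLHS](prob_integral_cst (G n)); apply: ge0_le_integral; try side.
  by move=> u _; rewrite lee_fin leNgt; apply/negP; exact: N.
by rewrite leNgt H.
Qed.

Lemma measurable_pr d (T : measurableType d) n (A : T -> n.-tuple R -> bool) :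
  mbool (fun p : T * n.-tuple R => A p.1 p.2) ->
  measurable_fun setT (fun x => pr (A x)).
Proof.
move=> mA; apply: (measurableT_comp (f := @fine R)); first exact: fine_measurable.
apply: (@measurable_integral _ _ _ _ _ (G n) (fun x z => ((A x z)%:R : R)%:E)).
- by apply/measurable_EFinP.
- by move=> x y; rewrite lee_fin.
Qed.

Lemma mbool_section d (T : measurableType d) n (A : T -> n.-tuple R -> bool) x :
  mbool (fun p : T * n.-tuple R => A p.1 p.2) -> mbool (A x).
Proof.
move=> mA; apply: (@mbool_comp R _ _ _ _ (fun p : T * n.-tuple R => A p.1 p.2) (fun z => (x, z)) mA).
exact: pair1_measurable.
Qed.

Lemma integral_pr n m (A : n.-tuple R -> m.-tuple R -> bool) :
  mbool (fun p => A p.1 p.2) ->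
  (\int[G n]_u (pr (A u))%:E = \int[G n]_u \int[G m]_z ((A u z)%:R : R)%:E)%E.
Proof.
move=> mA; apply: eq_integral => u _; rewrite prE //; exact: (mbool_section u mA).
Qed.

(** Averaged over Gaussian words, a codeword or an interferer acts as additional Gaussian noise. *)
Lemma integral_pr_conv n (al be ga : R) (A : n.-tuple R -> bool) :
  0 < be -> 0 < ga -> ga ^+ 2 = al ^+ 2 + be ^+ 2 -> mbool A ->
  (\int[G n]_u (pr (fun z => A (tadd (tscale al u) (tscale be z))))%:E =
   (pr (fun v => A (tscale ga v)))%:E)%E.
Proof.
move=> be0 ga0 gE mA; have mA' := mA; rewrite /measurable_bool in mA'.
rewrite integral_pr; last first.
  by apply: (@mbool_comp R _ _ _ _ A) => //; meas.
rewrite (@gauss_conv R n al be ga (fun y => ((A y)%:R : R)%:E)) //; try side.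
rewrite prE //; apply: (@mbool_comp R _ _ _ _ A) => //.
by apply: (@measurable_tscale R _ _ n ga id); exact: measurable_id.
Qed.

End tails.

#[local] Hint Extern 0 (is_true (@Order.le _ _ _ (pr _))) => solve [exact: pr_ge0] : core.
#[local] Hint Extern 0 (is_true (@Order.le _ _ _ (tail_base _))) => solve [exact: tail_base_ge0] : core.

(** * Greedy choice of codewords *)

Section greedy.
Variable R : realType.
Notation G := (gauss R).
Notation mbool := (measurable_bool R).

(* The information density of [(x, y)] exceeds [n t]; it is the opposite of the logarithm of
   the likelihood ratio. *)
Definition typical n (s t : R) (x y : n.-tuple R) : bool :=
  lratio s x (tadd y (tscale (-1) x)) < expR (- (n%:R * t)).

Lemma mbool_typical d (T : measurableType d) n (s t : R) (f g : T -> n.-tuple R) :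
  measurable_fun setT f -> measurable_fun setT g -> mbool (fun p => typical s t (f p) (g p)).
Proof. by move=> mf mg; apply: mbool_lt; meas. Qed.

(** A change of measure to the outputs of [x]: on the typical set the ratio of the two laws is below
    [expR (- (n * t))] by definition. *)
Lemma pr_typical_indep n (s t : R) (x : n.-tuple R) : 0 < s ->
  pr (fun v => typical s t x (tscale s v)) <= expR (- (n%:R * t)).
Proof.
move=> s0; have mid : measurable_fun setT (fun y : n.-tuple R => y) by exact: measurable_id.
have mT : mbool (fun y => typical s t x y) by apply: mbool_typical => //; exact: measurable_cst.
have mT' := mT; rewrite /measurable_bool in mT'.
rewrite -lee_fin -prE; last by apply: (mbool_comp mT); meas.
rewrite (@gauss_lratio R n s x (fun y => ((typical s t x y)%:R : R)%:E)) //; try side.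
rewrite -[leRHS](prob_integral_cst (G n)).
have mT2 : measurable_fun setT (fun z => (typical s t x (tadd x z))%:R : R).
  by apply: (mbool_comp mT); meas.
apply: ge0_le_integral; try side.
move=> z _; rewrite -EFinM lee_fin /typical tadd_subK.
by case: ltP => [/ltW|_]; rewrite ?mul1r // mul0r expR_ge0.
Qed.

(** If the noise energy is below [n (1 + de)] and the normalized output energy above [n (1 - de)],
    the log-ratio is below [n (de - ln s)], hence below [- n t]. *)
Lemma not_typical n (s t de : R) (x z : n.-tuple R) : 0 < s -> t + de <= ln s ->
  ~~ typical s t x (tadd x z) ->
  (n%:R * (1 + de) <= sqnorm z) || (sqnorm (tscale s^-1 (tadd x z)) <= n%:R * (1 - de)).
Proof.
move=> s0 tl; rewrite /typical tadd_subK -leNgt => h.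
case: leP => //= h1; rewrite leNgt; apply/negP => h2.
have : - (n%:R * t) <= ln (lratio s x z).
  by rewrite -[leLHS]expRK ler_ln ?posrE ?expR_gt0 ?lratio_gt0.
rewrite ln_lratio // sqnorm_scale in h2 *.
have -> : sqnorm (tadd x z) / (2 * s ^+ 2) = (s^-1 ^+ 2 * sqnorm (tadd x z)) / 2.
  by field; rewrite gt_eqF.
have := ler_wpM2l (ler0n R n) tl.
lra.
Qed.

Variables (n : nat) (P Q t de s eta : R) (g : n.-tuple R -> R).
Hypotheses (Q0 : 0 < Q) (s0 : 0 < s) (sE : s ^+ 2 = 1 + Q) (d0 : 0 < de) (d1 : de < 1)
  (QP : Q * (1 + de) <= P) (tl : t + de <= ln s)
  (mg : measurable_fun setT g) (g0 : forall x, 0 <= g x)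
  (geta : (\int[G n]_u (g (tscale (Num.sqrt Q) u))%:E <= eta%:E)%E).

(** The cost of [y] as codeword number [k]: its output is not typical for it, its output is typical
    for an earlier word, the power constraint fails (which alone costs 1), and the side cost. Later
    words do not matter, as the decoder picks the first typical word. *)
Definition greedy_cost (x : nat -> n.-tuple R) (k : nat) (y : n.-tuple R) : R :=
  pr (fun z => ~~ typical s t y (tadd y z)) +
  \sum_(j < k) pr (fun z => typical s t (x j) (tadd y z)) +
  (n%:R * P < sqnorm y)%R%:R + g y.

Let q := Num.sqrt Q.
Let q0 : 0 < q. Proof. by rewrite sqrtr_gt0. Qed.
Let qs : s ^+ 2 = q ^+ 2 + 1 ^+ 2. Proof. by rewrite sqr_sqrtr ?ltW // sE expr1n addrC. Qed.

Let mid : measurable_fun setT (fun u : n.-tuple R => u).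
Proof. exact: measurable_id. Qed.

Let mcost1 : measurable_fun setT (fun y : n.-tuple R => pr (fun z => ~~ typical s t y (tadd y z))).
Proof.
apply: (@measurable_pr R _ _ n (fun y z => ~~ typical s t y (tadd y z))).
by apply: mboolN; apply: mbool_typical; meas.
Qed.

Let mcost2 (x : n.-tuple R) : measurable_fun setT (fun y : n.-tuple R => pr (fun z => typical s t x (tadd y z))).
Proof.
apply: (@measurable_pr R _ _ n (fun y z => typical s t x (tadd y z))).
by apply: mbool_typical; meas.
Qed.

Let mcost3 : measurable_fun setT (fun y : n.-tuple R => (n%:R * P < sqnorm y)%R%:R : R).
Proof. by apply: mbool_lt; [exact: measurable_cst | exact: measurable_sqnorm_id]. Qed.

Let avg_conv (A : n.-tuple R -> bool) : mbool A ->
  (\int[G n]_u (pr (fun z => A (tadd (tscale q u) z)))%:E = (pr (fun v => A (tscale s v)))%:E)%E.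
Proof.
move=> mA; rewrite -(@integral_pr_conv R n q 1 s A ltr01 s0 qs mA).
by apply: eq_integral => u _; congr EFin; apply: eq_pr => z; rewrite tscale1.
Qed.

(** [not_typical] splits the event in two. The noise tail is uniform in [u]; the output tail is
    averaged over [u], where the output is N(0, s^2). *)
Let cost1 : (\int[G n]_u (pr (fun z => ~~ typical s t (tscale q u) (tadd (tscale q u) z)))%:E <=
  (tail_base (1 + de) ^+ n + tail_base (1 - de) ^+ n)%:E)%E.
Proof.
pose B (y : n.-tuple R) : bool := sqnorm (tscale s^-1 y) <= n%:R * (1 - de).
have mB : mbool B by apply: mbool_le; meas.
have mA : mbool (fun z : n.-tuple R => n%:R * (1 + de) <= sqnorm z).
  by apply: mbool_le; [exact: measurable_cst | exact: measurable_sqnorm_id].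
have mBu u : mbool (fun z => B (tadd (tscale q u) z)) by apply: (mbool_comp mB); meas.
have mprB : measurable_fun setT (fun u => pr (fun z => B (tadd (tscale q u) z))).
  apply: (@measurable_pr R _ _ n (fun u z => B (tadd (tscale q u) z))).
  by apply: (mbool_comp mB); meas.
have mq : measurable_fun setT (fun u : n.-tuple R => tscale q u) by meas.
apply: (@le_trans _ _ (\int[G n]_u ((tail_base (1 + de) ^+ n)%:E + (pr (fun z => B (tadd (tscale q u) z)))%:E))%E).
  have mc := measurableT_comp mcost1 mq.
  apply: ge0_le_integral => //.
  - by move=> u _; rewrite lee_fin pr_ge0.
  - by apply/measurable_EFinP.
  - meas.
  move=> u _; rewrite -EFinD lee_fin.
  apply: (@le_trans _ _ (pr (fun z => (n%:R * (1 + de) <= sqnorm z) || B (tadd (tscale q u) z)))).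
    apply: le_pr.
    - by apply: mboolN; apply: mbool_typical; meas.
    - exact: mboolU.
    - by move=> z; exact: not_typical.
  apply: le_trans (prU mA (mBu u)) _; rewrite lerD2r.
  by apply: pr_sqnorm_ge; rewrite ltrDl.
rewrite ge0_integralD; try side.
rewrite prob_integral_cst avg_conv // -EFinD lee_fin lerD2l.
have -> : pr (fun v => B (tscale s v)) = pr (fun v : n.-tuple R => sqnorm v <= n%:R * (1 - de)).
  apply: eq_pr => v; rewrite /B; congr (sqnorm _ <= _); tup; field; exact: lt0r_neq0.
by apply: pr_sqnorm_le; rewrite ?subr_gt0 ?gtrBl.
Qed.

(** The output of a random new word is N(0, s^2), independent of the earlier word [x]. *)
Let cost2 (x : n.-tuple R) :
  (\int[G n]_u (pr (fun z => typical s t x (tadd (tscale q u) z)))%:E <= (expR (- (n%:R * t)))%:E)%E.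
Proof.
rewrite (avg_conv (A := typical s t x)); first by rewrite lee_fin pr_typical_indep.
by apply: mbool_typical => //; exact: measurable_cst.
Qed.

Let cost3 : (\int[G n]_u ((n%:R * P < sqnorm (tscale q u))%R%:R : R)%:E <= (tail_base (1 + de) ^+ n)%:E)%E.
Proof.
have mA : mbool (fun u : n.-tuple R => n%:R * P < sqnorm (tscale q u)) by apply: mbool_lt; meas.
rewrite prE // lee_fin.
apply: le_trans (pr_sqnorm_ge n (_ : 1 < 1 + de)); last by rewrite ltrDl.
apply: le_pr => //.
  by apply: mbool_le; [exact: measurable_cst | exact: measurable_sqnorm_id].
move=> u; rewrite sqnorm_scale sqr_sqrtr; last exact: ltW.
move=> h; rewrite -(ler_pM2l Q0); apply: ltW; apply: le_lt_trans h.
by rewrite mulrCA ler_wpM2l.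
Qed.

Lemma measurable_greedy_cost x k : measurable_fun setT (greedy_cost x k).
Proof.
rewrite /greedy_cost; apply: measurable_funD => //; apply: measurable_funD => //.
by apply: measurable_funD => //; apply: measurable_sum.
Qed.

Lemma greedy_cost_ge0 x k y : 0 <= greedy_cost x k y.
Proof. by rewrite /greedy_cost !addr_ge0 // sumr_ge0. Qed.

Lemma avg_greedy_cost x k : (\int[G n]_u (greedy_cost x k (tscale q u))%:E <=
  (2 * tail_base (1 + de) ^+ n + tail_base (1 - de) ^+ n + k%:R * expR (- (n%:R * t)) + eta)%:E)%E.
Proof.
have mq : measurable_fun setT (fun u : n.-tuple R => tscale q u) by meas.
have m1 := measurableT_comp mcost1 mq.
have m2 j := measurableT_comp (mcost2 (x j)) mq.
have m3 := measurableT_comp mcost3 mq.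
have m4 := measurableT_comp mg mq.
have m2s : measurable_fun setT (fun u => \sum_(j < k) pr (fun z => typical s t (x j) (tadd (tscale q u) z))).
  by apply: measurable_sum => j; exact: m2.
have s0' u : 0 <= \sum_(j < k) pr (fun z => typical s t (x j) (tadd (tscale q u) z)).
  by rewrite sumr_ge0.
rewrite /greedy_cost.
under eq_integral do rewrite !EFinD.
rewrite ge0_integralD; try side.
rewrite ge0_integralD; try side.
rewrite ge0_integralD; try side.
under [X in (_ + X + _ + _)%E]eq_integral do rewrite -sumEFin.
rewrite ge0_integral_sum; try side.
  rewrite !EFinD; apply: leeD => //.
  have h2 : (\sum_(j < k) \int[G n]_u (pr (fun z => typical s t (x j) (tadd (tscale q u) z)))%:E <=
     (k%:R * expR (- (n%:R * t)))%:E)%E.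
    have -> : ((k%:R * expR (- (n%:R * t)))%:E = \sum_(j < k) (expR (- (n%:R * t)))%:E)%E.
      by rewrite sumEFin sumr_const card_ord mulr_natl.
    by apply: lee_sum => j _; exact: cost2.
  have := leeD (leeD cost1 h2) cost3; move/le_trans; apply.
  rewrite -!EFinD lee_fin le_eqVlt; apply/orP; left; apply/eqP; ring.
by move=> j; apply/measurable_EFinP; exact: m2.
Qed.

Lemma eq_greedy_cost x x' k y : (forall j, (j < k)%N -> x j = x' j) ->
  greedy_cost x k y = greedy_cost x' k y.
Proof.
move=> h.
have e1 : \sum_(j < k) pr (fun z => typical s t (x j) (tadd y z)) =
    \sum_(j < k) pr (fun z => typical s t (x' j) (tadd y z)).
  by apply: eq_bigr => j _; rewrite (h j (ltn_ord j)).
exact: (congr1 (fun S => pr (fun z => ~~ typical s t y (tadd y z)) + S +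
  (n%:R * P < sqnorm y)%R%:R + g y) e1).
Qed.

(** Whatever words are already chosen, a Gaussian word has mean cost below [e], so a suitable next
    word exists. Appending it leaves earlier costs unchanged, since each depends on preceding words
    only. *)
Lemma greedy_codebook (e : R) M :
  2 * tail_base (1 + de) ^+ n + tail_base (1 - de) ^+ n + M%:R * expR (- (n%:R * t)) + eta < e ->
  exists x : nat -> n.-tuple R, forall i, (i < M)%N -> greedy_cost x i (x i) < e.
Proof.
(* The induction is on the number of words already chosen; [M] stays fixed in the bound [tot]. *)
move=> tot; elim: {-2}M (leqnn M) => [_|k IH kM].
  by exists (fun _ => [tuple 0 | _ < n]).
have [x hx] := IH (ltnW kM).
have [u hu] : exists u, greedy_cost x k (tscale q u) < e.
  apply: exists_lt_integral.
  - by apply: (measurableT_comp (measurable_greedy_cost x k)); meas.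
  - by move=> u; exact: greedy_cost_ge0.
  - apply: le_lt_trans (avg_greedy_cost x k) _; rewrite lte_fin; apply: le_lt_trans tot.
    rewrite lerD2r lerD2l ler_wpM2r ?expR_ge0 // ler_nat; exact: ltnW.
exists (fun i => if i == k then tscale q u else x i) => i.
have ext j y : (j <= k)%N -> greedy_cost (fun i => if i == k then tscale q u else x i) j y = greedy_cost x j y.
  move=> jk; apply: eq_greedy_cost => l lj.
  by rewrite ltn_eqF // (leq_trans lj).
rewrite ltnS leq_eqVlt => /orP[/eqP ->|ik]; first by rewrite eqxx ext.
by rewrite ltn_eqF // ext ?(ltnW ik) //; exact: hx.
Qed.

End greedy.

(** * The first-typical decoder *)

Section decoder.
Variable R : realType.
Notation G := (gauss R).
Notation mbool := (measurable_bool R).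

Lemma mboolI d (T : measurableType d) (A B : T -> bool) :
  mbool A -> mbool B -> mbool (fun x => A x && B x).
Proof.
move=> mA mB; rewrite /measurable_bool.
have -> : (fun x => (A x && B x)%:R : R) = (fun x => (A x)%:R * (B x)%:R).
  by apply/funext => x; case: (A x); case: (B x); rewrite /= ?(mulr1, mulr0).
by rewrite /measurable_bool in mA mB; meas.
Qed.

Lemma mbool_cst d (T : measurableType d) (b : bool) : mbool (fun _ : T => b).
Proof. exact: measurable_cst. Qed.

Lemma mbool_find d (T : measurableType d) (a : nat -> T -> bool) (r : seq nat) k :
  (forall i, mbool (a i)) -> mbool (fun y => find (a^~ y) r == k).
Proof.
move=> ma; elim: r k => [|i r IH] k /=; first exact: mbool_cst.
case: k => [|k].
  rewrite (_ : (fun y => _) = a i) //; apply/funext => y; by case: (a i y).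
rewrite (_ : (fun y => _) = (fun y => ~~ a i y && (find (a^~ y) r == k))).
  by apply: mboolI => //; exact: mboolN.
by apply/funext => y; case: (a i y).
Qed.

Lemma mbool_has d (T : measurableType d) (a : nat -> T -> bool) (r : seq nat) :
  (forall i, mbool (a i)) -> mbool (fun y => has (a^~ y) r).
Proof.
move=> ma; elim: r => [|i r IH] /=; first exact: mbool_cst.
exact: mboolU.
Qed.

Lemma pr_has n (a : nat -> n.-tuple R -> bool) (r : seq nat) :
  (forall i, mbool (a i)) -> pr (fun y => has (a^~ y) r) <= \sum_(i <- r) pr (a i).
Proof.
move=> ma; elim: r => [|i r IH] /=.
  by rewrite big_nil /pr integral0.
rewrite big_cons; apply: le_trans (prU (ma i) (mbool_has r ma)) _.
by rewrite lerD2l.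
Qed.

(* If no word is typical, [find] returns [m.+1], which [inord] sends to [ord0]. *)
Definition first_typical n m (s t : R) (x : nat -> n.-tuple R) (y : n.-tuple R) : 'I_m.+1 :=
  inord (find (fun i => typical s t (x i) y) (iota 0 m.+1)).

Lemma mbool_preimage n M (d : n.-tuple R -> 'I_M) m :
  mbool (fun y => d y == m) -> measurable (d @^-1` [set m]).
Proof.
move=> md; have := md measurableT [set 1] (measurable_set1 1); rewrite setTI.
congr measurable; apply/seteqP; split => y /=.
  by move=> h; apply/eqP; move: h; case: (d y == m) => //= /eqP; rewrite eq_sym oner_eq0.
by move=> ->; rewrite eqxx.
Qed.

Lemma measurable_first_typical n m s t (x : nat -> n.-tuple R) i :
  measurable (@first_typical n m s t x @^-1` [set i]).
Proof.
apply: mbool_preimage; pose F y := find (fun i => typical s t (x i) y) (iota 0 m.+1).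
have mF k : mbool (fun y => F y == k).
  apply: (mbool_find (a := fun i y => typical s t (x i) y)) => j.
  by apply: mbool_typical; [exact: measurable_cst | exact: measurable_id].
have FE y : (first_typical m s t x y == i) = (F y == i) || ((F y == m.+1) && (i == ord0)).
  rewrite /first_typical -/(F y) -val_eqE /= val_insubd.
  have : (F y <= m.+1)%N by rewrite -[leqRHS](size_iota 0 m.+1) find_size.
  rewrite leq_eqVlt => /orP[/eqP ->|h].
    by rewrite ltnn eqxx (gtn_eqF (ltn_ord i)) -val_eqE /= eq_sym.
  by rewrite h (ltn_eqF h) /= orbF.
rewrite (_ : (fun y => _) = (fun y => (F y == i) || ((F y == m.+1) && (i == ord0)))); last exact/funext.
apply: mboolU => //; apply: mboolI => //; exact: mbool_cst.
Qed.

Lemma first_typical_err n m s t (x : nat -> n.-tuple R) (i : 'I_m.+1) y :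
  first_typical m s t x y != i ->
  ~~ typical s t (x i) y || has (fun j => typical s t (x j) y) (iota 0 i).
Proof.
apply: contraR; rewrite negb_or negbK => /andP[ti nj].
rewrite /first_typical.
have -> : iota 0 m.+1 = iota 0 i ++ (i : nat) :: iota i.+1 (m - i).
  have e : (i + (m - i).+1)%N = m.+1 by rewrite addnS subnKC // -ltnS.
  by rewrite -[in LHS]e iotaD.
by rewrite find_cat (negbTE nj) /= ti size_iota addn0 inord_val.
Qed.

Lemma greedy_code n m (P Q t de s eta e : R) (g : n.-tuple R -> R) :
  0 < Q -> 0 < s -> s ^+ 2 = 1 + Q -> 0 < de -> de < 1 -> Q * (1 + de) <= P -> t + de <= ln s ->
  measurable_fun setT g -> (forall x, 0 <= g x) ->
  (\int[G n]_u (g (tscale (Num.sqrt Q) u))%:E <= eta%:E)%E ->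
  2 * tail_base (1 + de) ^+ n + tail_base (1 - de) ^+ n + m.+1%:R * expR (- (n%:R * t)) + eta < e ->
  e <= 1 ->
  exists (enc : 'I_m.+1 -> n.-tuple R) (dec : n.-tuple R -> 'I_m.+1),
    [/\ forall i, power_ok P (enc i), forall i, measurable (dec @^-1` [set i]),
        forall i, pr (fun z => dec (tadd (enc i) z) != i) <= e & forall i, g (enc i) <= e].
Proof.
move=> Q0 s0 sE d0 d1 QP tl mg g0 geta tot e1.
have [x hx] := greedy_codebook Q0 s0 sE d0 d1 QP tl mg g0 geta tot.
exists (fun i => x i), (first_typical m s t x).
have c0 (i : 'I_m.+1) : 0 <= pr (fun z => ~~ typical s t (x i) (tadd (x i) z)) +
  \sum_(j < i) pr (fun z => typical s t (x j) (tadd (x i) z)).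
  by rewrite addr_ge0 // sumr_ge0.
clear geta; split.
(* A violated constraint alone would cost 1, which is at least [e]. *)
- move=> i; rewrite /power_ok -/(sqnorm _) leNgt; apply/negP => bad.
  have := hx i (ltn_ord i); rewrite /greedy_cost bad /=.
  have := c0 i; have := g0 (x i); lra.
- exact: measurable_first_typical.
- move=> i; have := hx i (ltn_ord i); rewrite /greedy_cost => /ltW h.
  apply: le_trans h; rewrite -addrA; apply: le_trans (_ : pr (fun z => ~~ typical s t (x i) (tadd (x i) z)) +
    \sum_(j < i) pr (fun z => typical s t (x j) (tadd (x i) z)) <= _); last first.
    by rewrite lerDl addr_ge0.
  have mt j : mbool (fun z => typical s t (x j) (tadd (x i) z)).
    by apply: mbool_typical; meas.
  have mh := mbool_has (iota 0 i) mt.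
  apply: le_trans (_ : pr (fun z => ~~ typical s t (x i) (tadd (x i) z) ||
     has (fun j => typical s t (x j) (tadd (x i) z)) (iota 0 i)) <= _).
    apply: le_pr.
    - by apply: mbool_dec_shift; exact: measurable_first_typical.
    - by apply: mboolU => //; exact: mboolN.
    - by move=> z; exact: first_typical_err.
  apply: le_trans (prU (mboolN (mt i)) mh) _; rewrite lerD2l.
  apply: le_trans (pr_has (iota 0 i) mt) _.
  by rewrite -(big_mkord xpredT (fun j => pr (fun z => typical s t (x j) (tadd (x i) z)))) /index_iota subn0.
- move=> i; have := hx i (ltn_ord i); rewrite /greedy_cost => /ltW h.
  by apply: le_trans h; rewrite lerDr addr_ge0.
Qed.

End decoder.

(** * Gaussian channel codes with a side cost *)

Section awgn.
Variable R : realType.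
Notation G := (gauss R).

Lemma powR2E (x : R) : 2 `^ x = expR (x * ln 2).
Proof. by rewrite -ln_powR lnK // posrE powR_gt0. Qed.

(** [Q] and [th] are fixed before the length and the side cost, because the side costs used later
    are averaged over words of power [Q]. *)
Lemma awgn_code (P r : R) : 0 < P -> 0 <= r -> r * ln 2 < ln (1 + P) / 2 ->
  exists Q th : R, [/\ 0 < Q, Q < P, 0 < th, th < 1 &
   forall n (g : n.-tuple R -> R) (eta : R),
    measurable_fun setT g -> (forall x, 0 <= g x) ->
    (\int[G n]_u (g (tscale (Num.sqrt Q) u))%:E <= eta%:E)%E ->
    6 * th ^+ n + eta <= 1 ->
    exists m (enc : 'I_m.+1 -> n.-tuple R) (dec : n.-tuple R -> 'I_m.+1),
    2 `^ (n%:R * r) <= m.+1%:R /\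
    [/\ forall i, power_ok P (enc i), forall i, measurable (dec @^-1` [set i]),
        forall i, pr (fun z => dec (tadd (enc i) z) != i) <= 6 * th ^+ n + eta &
        forall i, g (enc i) <= 6 * th ^+ n + eta]].
Proof.
move=> P0 r0 rP; set L := ln (1 + P) / 2 in rP.
(* At most half the gap between rate and capacity, so that [t = L - 3 / 2 * de] still exceeds
   [r * ln 2]. *)
pose de := Num.min ((L - r * ln 2) / 2) 2^-1.
have d0 : 0 < de by rewrite lt_min; lra.
have dg : de <= (L - r * ln 2) / 2 by rewrite ge_min lexx.
have dh : de <= 2^-1 by rewrite ge_min lexx orbT.
have d1 : de < 1 by lra.
have d10 : 0 < 1 + de by lra.
pose Q := P / (1 + de).
have Q0 : 0 < Q by rewrite divr_gt0.
have QP : Q * (1 + de) = P by rewrite divfK // gt_eqF.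
have QltP : Q < P by rewrite -QP ltr_pMr // ltrDl.
pose s := Num.sqrt (1 + Q).
have Q10 : 0 < 1 + Q by lra.
have s0 : 0 < s by rewrite sqrtr_gt0.
have sE : s ^+ 2 = 1 + Q by rewrite sqr_sqrtr // ltW.
pose t := L - 3 / 2 * de.
(* [1 + Q] is at least [(1 + P) / (1 + de)], and [ln (1 + de) <= de]. *)
have lns : L - de / 2 <= ln s.
  have h2 : 2 * ln s = ln (1 + Q) by rewrite -sE lnXn // mulr_natl.
  have h3 : ln (1 + P) - ln (1 + de) <= ln (1 + Q).
    rewrite -ln_div ?posrE //; last lra.
    rewrite ler_ln ?posrE ?divr_gt0 //; last lra.
    by rewrite ler_pdivrMr // -QP; nra.
  have h4 : ln (1 + de) <= de by rewrite -[leRHS]expRK ler_ln ?posrE ?expR_gt0 //; exact: expR_ge1Dx.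
  by rewrite /L; lra.
have tl : t + de <= ln s by rewrite /t; lra.
have tr : r * ln 2 < t by rewrite /t; lra.
pose th3 := expR (- (t - r * ln 2)).
have th30 : 0 < th3 by exact: expR_gt0.
have th31 : th3 < 1 by rewrite expR_lt1 oppr_lt0 subr_gt0.
have /andP[ta0 ta1] := @tail_base_lt1 R (1 + de) d10 ltac:(by rewrite gt_eqF // ltrDl).
have /andP[tb0 tb1] := @tail_base_lt1 R (1 - de) ltac:(by rewrite subr_gt0) ltac:(by rewrite lt_eqF // gtrBl).
pose th := Num.max (tail_base (1 + de)) (Num.max (tail_base (1 - de)) th3).
have tha : tail_base (1 + de) <= th by rewrite le_max lexx.
have thb : tail_base (1 - de) <= th by rewrite !le_max lexx orbT.
have thc : th3 <= th by rewrite !le_max lexx !orbT.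
have th0 : 0 < th by exact: lt_le_trans tha.
have th1 : th < 1 by rewrite !gt_max ta1 tb1.
exists Q, th; split => // n g eta mg g0 geta le1.
pose m := Num.truncn (2 `^ (n%:R * r)).
have p0 : 0 < 2 `^ (n%:R * r) by rewrite powR_gt0.
have ml : m%:R <= 2 `^ (n%:R * r) by rewrite truncn_le // ltW.
have mg1 : 2 `^ (n%:R * r) < m.+1%:R by exact: truncnS_gt.
have p1 : 1 <= 2 `^ (n%:R * r).
  rewrite powR2E -[leLHS]expR0 ler_expR mulr_ge0 ?mulr_ge0 // ln_ge0 //; lra.
have thn : 0 < th ^+ n by rewrite exprn_gt0.
have b3 : m.+1%:R * expR (- (n%:R * t)) <= 2 * th ^+ n.
  apply: (@le_trans _ _ (2 * 2 `^ (n%:R * r) * expR (- (n%:R * t)))).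
    by rewrite ler_wpM2r ?expR_ge0 // -natr1; lra.
  rewrite -mulrA powR2E -expRD.
  have -> : n%:R * r * ln 2 + - (n%:R * t) = n%:R * - (t - r * ln 2) by ring.
  rewrite expRM_natl -/th3 ler_pM2l // lerXn2r ?nnegrE // ltW //.
have ba : tail_base (1 + de) ^+ n <= th ^+ n by rewrite lerXn2r ?nnegrE // ltW.
have bb : tail_base (1 - de) ^+ n <= th ^+ n by rewrite lerXn2r ?nnegrE // ltW.
(* The terms other than [eta] amount to at most [(2 + 1 + 2) * th ^+ n]; the constant 6 makes the
   inequality strict. *)
have tot : 2 * tail_base (1 + de) ^+ n + tail_base (1 - de) ^+ n +
  m.+1%:R * expR (- (n%:R * t)) + eta < 6 * th ^+ n + eta.
  by clear geta; lra.
have QP' : Q * (1 + de) <= P by rewrite QP.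
have [enc [dec h]] := greedy_code Q0 s0 sE d0 d1 QP' tl mg g0 geta tot le1.
by exists m, enc, dec; split => //; exact: ltW.
Qed.

End awgn.

(** * Decoding user 2 through Gaussian interference *)

Section side_decoders.
Variable R : realType.
Notation G := (gauss R).
Notation mbool := (measurable_bool R).

Lemma mbool_dec_comp d (T : measurableType d) n M (D : n.-tuple R -> 'I_M) (f : T -> n.-tuple R) m :
  (forall m, measurable (D @^-1` [set m])) -> measurable_fun setT f ->
  mbool (fun x => D (f x) != m).
Proof.
move=> mD mf; apply: mboolN; apply: (@mbool_comp R _ _ _ _ (fun y => D y == m) f) => //.
exact: mbool_dec.
Qed.

Lemma measurable_dec_comp n M (D : n.-tuple R -> 'I_M) (f : n.-tuple R -> n.-tuple R) :
  (forall m, measurable (D @^-1` [set m])) -> measurable_fun setT f ->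
  forall m, measurable ((fun y => D (f y)) @^-1` [set m]).
Proof.
move=> mD mf m; have := mf measurableT _ (mD m).
by rewrite setTI.
Qed.

(* Adding noise of variance [ka^2] to a channel of noise variance [tau^2] gives back the
   original error probability on average; some fixed noise vector does as well as the average. *)
Lemma degraded_decoder n M (enc : 'I_M -> n.-tuple R) (dec : n.-tuple R -> 'I_M) (e e' tau ka : R) :
  (0 < M)%N -> 0 < tau -> ka ^+ 2 + tau ^+ 2 = 1 ->
  (forall m, measurable (dec @^-1` [set m])) ->
  (forall i, pr (fun z => dec (tadd (enc i) z) != i) <= e) -> e < e' ->
  exists u0, \sum_i pr (fun v => dec (tadd (enc i) (tadd (tscale ka u0) (tscale tau v))) != i) < M%:R * e'.
Proof.
move=> M0 t0 kt md he ee.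
pose h u := \sum_i pr (fun v => dec (tadd (enc i) (tadd (tscale ka u) (tscale tau v))) != i).
have mhi i : measurable_fun setT (fun u => pr (fun v => dec (tadd (enc i) (tadd (tscale ka u) (tscale tau v))) != i)).
  apply: (@measurable_pr R _ _ n (fun u v => dec (tadd (enc i) (tadd (tscale ka u) (tscale tau v))) != i)).
  by apply: mbool_dec_comp => //; meas.
apply: (@exists_lt_integral R n h).
- by rewrite /h; apply: measurable_sum.
- by move=> u; apply: sumr_ge0 => i _.
rewrite /h; under eq_integral do rewrite -sumEFin.
rewrite ge0_integral_sum; try side.
  have mA i : mbool (fun y => dec (tadd (enc i) y) != i) by apply: mbool_dec_comp => //; meas.
  have g1 : 1 ^+ 2 = ka ^+ 2 + tau ^+ 2 :> R by rewrite expr1n kt.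
  apply: (@le_lt_trans _ _ (\sum_(i < M) e%:E)%E); last first.
    by rewrite sumEFin lte_fin sumr_const card_ord -[ltLHS]mulr_natl ltr_pM2l // ltr0n.
  apply: lee_sum => i _.
  rewrite (@integral_pr_conv R n ka tau 1 (fun y => dec (tadd (enc i) y) != i) t0 ltr01 g1 (mA i)).
  rewrite lee_fin; apply: le_trans (he i).
  by apply: le_pr => // [|z]; [apply: mbool_dec_comp => //; meas | rewrite tscale1].
by move=> i; apply/measurable_EFinP.
Qed.

(** The side cost for the codebooks of users 1 and 3: the average error of [D] on the words [c] when
    [x] interferes with gain [al]. *)
Definition interference_cost n M (D : n.-tuple R -> 'I_M) (c : 'I_M -> n.-tuple R) (al : R)
    (x : n.-tuple R) : R :=
  M%:R^-1 * \sum_w pr (fun z => D (tadd (tadd (c w) (tscale al x)) z) != w).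

Lemma interference_cost_ge0 n M (D : n.-tuple R -> 'I_M) c al x : 0 <= interference_cost D c al x.
Proof. by rewrite mulr_ge0 // ?invr_ge0 // sumr_ge0. Qed.

Lemma measurable_interference_cost n M (D : n.-tuple R -> 'I_M) c al :
  (forall m, measurable (D @^-1` [set m])) ->
  measurable_fun setT (interference_cost D c al).
Proof.
move=> mD; apply: measurable_funM => //; apply: measurable_sum => w.
apply: (@measurable_pr R _ _ n (fun x z => D (tadd (tadd (c w) (tscale al x)) z) != w)).
by apply: mbool_dec_comp => //; meas.
Qed.

Lemma avg_interference_cost n M (D : n.-tuple R -> 'I_M) c (al Q ga : R) :
  0 <= Q -> 0 < ga -> ga ^+ 2 = al ^+ 2 * Q + 1 ->
  (forall m, measurable (D @^-1` [set m])) ->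
  (\int[G n]_u (interference_cost D c al (tscale (Num.sqrt Q) u))%:E =
   (M%:R^-1 * \sum_w pr (fun v => D (tadd (c w) (tscale ga v)) != w))%:E)%E.
Proof.
move=> Q0 ga0 gE mD; rewrite /interference_cost.
have mw w : measurable_fun setT (fun u => pr (fun z => D (tadd (tadd (c w) (tscale al (tscale (Num.sqrt Q) u))) z) != w)).
  apply: (@measurable_pr R _ _ n (fun u z => D (tadd (tadd (c w) (tscale al (tscale (Num.sqrt Q) u))) z) != w)).
  by apply: mbool_dec_comp => //; meas.
have ms : measurable_fun setT (fun u => \sum_w pr (fun z => D (tadd (tadd (c w) (tscale al (tscale (Num.sqrt Q) u))) z) != w)).
  by apply: measurable_sum.
under eq_integral do rewrite EFinM.
rewrite ge0_integralZl; try side.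
  rewrite [RHS]EFinM; congr (_ * _)%E.
  under eq_integral do rewrite -sumEFin.
  rewrite ge0_integral_sum; try side.
    rewrite -sumEFin; apply: eq_bigr => w _.
    have mA : mbool (fun y => D (tadd (c w) y) != w) by apply: mbool_dec_comp => //; meas.
    have g1 : ga ^+ 2 = (al * Num.sqrt Q) ^+ 2 + 1 ^+ 2.
      by rewrite exprMn sqr_sqrtr // expr1n gE.
    rewrite -(@integral_pr_conv R n (al * Num.sqrt Q) 1 ga (fun y => D (tadd (c w) y) != w) ltr01 ga0 g1 mA).
    apply: eq_integral => u _; congr EFin; apply: eq_pr => z.
    by congr (D _ != _); tup; ring.
  by move=> w; apply/measurable_EFinP.
by move=> u _; rewrite lee_fin sumr_ge0.
Qed.

(** Dividing the output by [b] leaves, for Gaussian interference, a noise of standard deviation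
    [ga / b <= 1]. The fixed vector of [degraded_decoder] makes up for the missing noise, so [dec]
    still works. *)
Lemma side_decoder n M (enc : 'I_M -> n.-tuple R) (dec : n.-tuple R -> 'I_M) (e e' b ga al Q : R) :
  (0 < M)%N -> 0 < b -> 0 < ga -> ga <= b -> 0 <= Q -> ga ^+ 2 = al ^+ 2 * Q + 1 ->
  (forall m, measurable (dec @^-1` [set m])) ->
  (forall i, pr (fun z => dec (tadd (enc i) z) != i) <= e) -> e < e' ->
  exists D : n.-tuple R -> 'I_M, (forall m, measurable (D @^-1` [set m])) /\
  (\int[G n]_u (interference_cost D (fun w => tscale b (enc w)) al (tscale (Num.sqrt Q) u))%:E <= e'%:E)%E.
Proof.
move=> M0 b0 ga0 gb Q0 gE md he ee.
pose tau := ga / b; have t0 : 0 < tau by rewrite divr_gt0.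
pose ka := Num.sqrt (1 - tau ^+ 2).
have kt : ka ^+ 2 + tau ^+ 2 = 1.
  have t1 : tau <= 1 by rewrite ler_pdivrMr // mul1r.
  by rewrite sqr_sqrtr ?subrK // subr_ge0 exprn_ile1 // ltW.
have [u0 hu0] := degraded_decoder M0 t0 kt md he ee.
exists (fun y => dec (tadd (tscale b^-1 y) (tscale ka u0))); split.
  by apply: measurable_dec_comp => //; meas.
rewrite (@avg_interference_cost n M _ _ al Q ga Q0 ga0 gE); last first.
  by apply: measurable_dec_comp => //; meas.
rewrite lee_fin ler_pdivrMl ?ltr0n //; apply: ltW; apply: le_lt_trans hu0.
apply: ler_sum => w _; apply: le_pr.
- by apply: mbool_dec_comp => //; meas.
- by apply: mbool_dec_comp => //; meas.
move=> v; have -> // : tadd (tscale b^-1 (tadd (tscale b (enc w)) (tscale ga v))) (tscale ka u0) =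
   tadd (enc w) (tadd (tscale ka u0) (tscale tau v)).
by tup; rewrite /tau; field; rewrite gt_eqF.
Qed.

End side_decoders.

(** * Assembling the three-user code *)

Section z_channel_code.
Variable R : realType.
Notation G := (gauss R).
Notation mbool := (measurable_bool R).

(** The indicator is a finite sum over the intermediate decision [w] of products of two measurable
    indicators. *)
Lemma measurable_cancel_dec n M M' (D : n.-tuple R -> 'I_M) (dec : n.-tuple R -> 'I_M')
    (c : 'I_M -> n.-tuple R) :
  (forall m, measurable (D @^-1` [set m])) -> (forall m, measurable (dec @^-1` [set m])) ->
  forall m, measurable ((fun y => dec (tadd y (tscale (-1) (c (D y))))) @^-1` [set m]).
Proof.
move=> mD md m; apply: mbool_preimage; rewrite /measurable_bool.
have -> : (fun y => (dec (tadd y (tscale (-1) (c (D y)))) == m)%:R : R) =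
  (fun y => \sum_w (D y == w)%:R * (dec (tadd y (tscale (-1) (c w))) == m)%:R).
  apply/funext => y; rewrite (bigD1 (D y)) //= eqxx mul1r big1 ?addr0 //.
  by move=> w; rewrite eq_sym => /negPf ->; rewrite mul0r.
apply: measurable_sum => w.
have h1 : measurable_fun setT (fun y => (D y == w)%:R : R) by exact: mbool_dec.
have h2 : measurable_fun setT (fun y => (dec (tadd y (tscale (-1) (c w))) == m)%:R : R).
  apply: (@mbool_comp R _ _ _ _ (fun y => dec y == m) (fun y => tadd y (tscale (-1) (c w)))); last meas.
  exact: mbool_dec.
exact: measurable_funM.
Qed.

Lemma power_ok_scale n (P b : R) (x : n.-tuple R) : 0 < b -> power_ok (P / b ^+ 2) x ->
  power_ok P (tscale b x).
Proof.
move=> b0; rewrite /power_ok -!/(sqnorm _) sqnorm_scale mulrA ler_pdivlMr ?exprn_gt0 //.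
by rewrite mulrC.
Qed.

Lemma union3_le (x y z : R) : 0 <= x <= 1 -> 0 <= y <= 1 -> 0 <= z <= 1 ->
  1 - (1 - x) * (1 - y) * (1 - z) <= x + y + z.
Proof.
move=> /andP[x0 x1] /andP[y0 y1] /andP[z0 z1].
have z1' : 0 <= 1 - z by lra.
have := mulr_ge0 (mulr_ge0 x0 y0) z1'; have := mulr_ge0 y0 z0; have := mulr_ge0 x0 z0.
lra.
Qed.

(** The union bound over the receivers. At receivers 2 and 3 the error is averaged over [w2] for a
    fixed interfering or desired word, the form supplied by [interference_cost]. *)
Lemma perr_ge_avg n M1 M2 M3 (a1 a2 P1 P2 P3 e1 e2 e3 : R) (c : Defs.code R n M1 M2 M3) :
  (0 < M1)%N -> (0 < M2)%N -> (0 < M3)%N -> admissible P1 P2 P3 c ->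
  (forall w1, err1 c w1 <= e1) ->
  (forall w1, \sum_w2 err2 a1 c w1 w2 <= M2%:R * e2) ->
  (forall w3, \sum_w2 err3 a2 c w2 w3 <= M2%:R * e3) ->
  (perr a1 a2 c <= (e1 + e2 + e3)%:E)%E.
Proof.
move=> M10 M20 M30 ad h1 h2 h3; rewrite /perr.
under eq_bigr do under eq_bigr do under eq_bigr do rewrite (perr_msgE _ _ _ _ _ ad).
under eq_bigr do under eq_bigr do rewrite sumEFin.
under eq_bigr do rewrite sumEFin.
rewrite sumEFin -EFinM lee_fin ler_pdivrMl ?ltr0n ?muln_gt0 ?M10 ?M20 // !natrM.
have cst (k : nat) (y : R) : \sum_(i < k) y = k%:R * y.
  by rewrite sumr_const card_ord mulr_natl.
apply: (@le_trans _ _ (\sum_(w1 < M1) \sum_(w2 < M2) \sum_(w3 < M3)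
   (err1 c w1 + err2 a1 c w1 w2 + err3 a2 c w2 w3))).
  apply: ler_sum => w1 _; apply: ler_sum => w2 _; apply: ler_sum => w3 _.
  by have [b1 b2 b3] := err_bounds a1 a2 w1 w2 w3 ad; exact: union3_le.
apply: (@le_trans _ _ (\sum_(w1 < M1) (M2%:R * M3%:R * (e1 + e2 + e3)))); last first.
  by rewrite cst !mulrA.
apply: ler_sum => w1 _; rewrite exchange_big /=.
apply: (@le_trans _ _ (\sum_(w3 < M3) (M2%:R * (e1 + e2 + e3)))); last first.
  by rewrite cst [M2%:R * M3%:R]mulrC mulrA.
apply: ler_sum => w3 _; rewrite !big_split /= cst !mulrDr.
apply: lerD; last exact: h3.
by apply: lerD; [rewrite ler_wpM2l | exact: h2].
Qed.

Lemma zic_code (a1 a2 P1 P2 P3 r1 r2 r3 : R) :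
  0 < P1 -> 0 < P2 -> 0 < P3 -> 0 < a2 -> 1 + P3 <= a2 ^+ 2 * (1 + a1 ^+ 2 * P1) ->
  0 <= r1 -> 0 <= r2 -> 0 <= r3 ->
  r1 * ln 2 < ln (1 + P1) / 2 -> r2 * ln 2 < ln (1 + P2 / (1 + a1 ^+ 2 * P1)) / 2 ->
  r3 * ln 2 < ln (1 + P3) / 2 ->
  exists th : R, [/\ 0 < th, th < 1 & forall n, 13 * th ^+ n <= 1 ->
    exists m1 m2 m3 (c : Defs.code R n m1.+1 m2.+1 m3.+1),
    [/\ admissible P1 P2 P3 c,
        [/\ 2 `^ (n%:R * r1) <= m1.+1%:R, 2 `^ (n%:R * r2) <= m2.+1%:R &
            2 `^ (n%:R * r3) <= m3.+1%:R]
      & (perr a1 a2 c <= (52 * th ^+ n)%:E)%E]].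
Proof.
move=> P10 P20 P30 a20 a2V r10 r20 r30 c1 c2 c3.
set V := 1 + a1 ^+ 2 * P1 in a2V c2.
have V0 : 0 < V by rewrite /V ltr_pwDl // mulr_ge0 ?sqr_ge0 // ltW.
have [Q1 [t1 [Q10 Q1P t10 t11 code1]]] := awgn_code P10 r10 c1.
have [Q2 [t2 [Q20 Q2P t20 t21 code2]]] := awgn_code (divr_gt0 P20 V0) r20 c2.
have [Q3 [t3 [Q30 Q3P t30 t31 code3]]] := awgn_code P30 r30 c3.
pose th := Num.max t1 (Num.max t2 t3).
have l1 : t1 <= th by rewrite le_max lexx.
have l2 : t2 <= th by rewrite !le_max lexx orbT.
have l3 : t3 <= th by rewrite !le_max lexx !orbT.
have th0 : 0 < th by exact: lt_le_trans l1.
exists th; split => //; first by rewrite !gt_max t11 t21.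
move=> n hn.
have thn : 0 < th ^+ n by rewrite exprn_gt0.
have le_th t : 0 < t -> t <= th -> t ^+ n <= th ^+ n.
  by move=> tt lt; rewrite lerXn2r ?nnegrE // ltW.
have k1 := le_th _ t10 l1; have k2 := le_th _ t20 l2; have k3 := le_th _ t30 l3.
pose v := Num.sqrt V.
have v0 : 0 < v by rewrite sqrtr_gt0.
have vV : v ^+ 2 = V by rewrite sqr_sqrtr // ltW.
(* User 2's code is built for unit noise and power [P2 / V], with zero side cost; its words are
   multiplied by [v] afterwards. *)
have [m2 [enc2' [dec2' [M2 [pw2 md2 er2 _]]]]] : exists m (enc : 'I_m.+1 -> n.-tuple R)
    (dec : n.-tuple R -> 'I_m.+1), 2 `^ (n%:R * r2) <= m.+1%:R /\
    [/\ forall i, power_ok (P2 / V) (enc i), forall i, measurable (dec @^-1` [set i]),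
        forall i, pr (fun z => dec (tadd (enc i) z) != i) <= 6 * t2 ^+ n + 0 &
        forall i : 'I_m.+1, (0 : R) <= 6 * t2 ^+ n + 0].
  apply: (code2 n (fun _ => 0) 0) => //.
  - by rewrite integral0.
  - lra.
have er2' i : pr (fun z => dec2' (tadd (enc2' i) z) != i) <= 6 * th ^+ n.
  by apply: le_trans (er2 i) _; lra.
have e67 : 6 * th ^+ n < 7 * th ^+ n by rewrite ltr_pM2r //; lra.
pose g1 := Num.sqrt (1 + a1 ^+ 2 * Q1).
have G1 : 0 < 1 + a1 ^+ 2 * Q1 by rewrite ltr_pwDl // mulr_ge0 ?sqr_ge0 // ltW.
have g10 : 0 < g1 by rewrite sqrtr_gt0.
have g1E : g1 ^+ 2 = a1 ^+ 2 * Q1 + 1 by rewrite sqr_sqrtr ?ltW // addrC.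
(* User 1's words have power [Q1 < P1], so receiver 2 has total noise variance below the design
   value [V]. *)
have g1v : g1 <= v.
  by rewrite ler_wsqrtr // lerD2l ler_wpM2l ?sqr_ge0 // ltW.
have [D2 [mD2 aD2]] := side_decoder (ltn0Sn m2) v0 g10 g1v (ltW Q10) g1E md2 er2' e67.
pose g3 := Num.sqrt (1 + Q3).
have G3 : 0 < 1 + Q3 by lra.
have g30 : 0 < g3 by rewrite sqrtr_gt0.
have g3E : g3 ^+ 2 = 1 ^+ 2 * Q3 + 1 by rewrite sqr_sqrtr ?ltW // expr1n mul1r addrC.
have b30 : 0 < a2 * v by rewrite mulr_gt0.
(* The lower bound on [a2]: even with [X3] as noise, receiver 3 sees [X2] at least as well as the
   design channel. *)
have g3v : g3 <= a2 * v.
  rewrite -(ler_pXn2r (ltn0Sn 1)) ?nnegrE ?ltW // exprMn vV sqr_sqrtr ?ltW //.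
  by apply: lt_le_trans a2V; lra.
have [D3 [mD3 aD3]] := side_decoder (ltn0Sn m2) b30 g30 g3v (ltW Q30) g3E md2 er2' e67.
(* The side cost has mean at most [7 * th ^+ n], so both errors are at most [6 + 7 = 13] times
   [th ^+ n]. *)
have [m1 [enc1 [dec1 [M1 [pw1 md1 er1 sc1]]]]] := code1 n _ (7 * th ^+ n)
  (measurable_interference_cost (fun w => tscale v (enc2' w)) a1 mD2)
  (interference_cost_ge0 D2 (fun w => tscale v (enc2' w)) a1) aD2 ltac:(clear aD2 aD3; lra).
have [m3 [enc3 [dec3 [M3 [pw3 md3 er3 sc3]]]]] := code3 n _ (7 * th ^+ n)
  (measurable_interference_cost (fun w => tscale (a2 * v) (enc2' w)) 1 mD3)
  (interference_cost_ge0 D3 (fun w => tscale (a2 * v) (enc2' w)) 1) aD3 ltac:(clear aD2 aD3; lra).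
pose enc2 w := tscale v (enc2' w).
pose dec3' y := dec3 (tadd y (tscale (-1) (tscale a2 (enc2 (D3 y))))).
have md3' m : measurable (dec3' @^-1` [set m]).
  exact: (measurable_cancel_dec (fun w => tscale a2 (enc2 w)) mD3 md3).
pose c := Code enc1 enc2 enc3 dec1 D2 dec3'.
have ad : admissible P1 P2 P3 c.
  split; split => //= w; apply: power_ok_scale => //.
  by rewrite vV; exact: pw2.
exists m1, m2, m3, c; split => //.
(* 13 for receiver 1, 13 for receiver 2, and 26 for the two stages of receiver 3. *)
have -> : 52 * th ^+ n = 13 * th ^+ n + 13 * th ^+ n + 26 * th ^+ n by ring.
apply: perr_ge_avg ad _ _ _ => //.
- by move=> w1; apply: le_trans (er1 w1) _; clear aD2 aD3; lra.
- move=> w1; have := sc1 w1; rewrite /interference_cost ler_pdivrMl ?ltr0n // => h.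
  apply: le_trans h _; rewrite ler_wpM2l //; clear aD2 aD3; lra.
- move=> w3.
  have h : \sum_w2 pr (fun z => D3 (tadd (tadd (tscale (a2 * v) (enc2' w2)) (tscale 1 (enc3 w3))) z) != w2)
     <= m2.+1%:R * (13 * th ^+ n).
    have := sc3 w3; rewrite /interference_cost ler_pdivrMl ?ltr0n // => h.
    by apply: le_trans h _; rewrite ler_wpM2l //; clear aD2 aD3; lra.
  have e (w2 : 'I_m2.+1) : err3 a2 c w2 w3 <=
    pr (fun z => D3 (tadd (tadd (tscale (a2 * v) (enc2' w2)) (tscale 1 (enc3 w3))) z) != w2) + 13 * th ^+ n.
    have mA : mbool (fun z => D3 (tadd (tadd (tscale (a2 * v) (enc2' w2)) (tscale 1 (enc3 w3))) z) != w2).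
      by apply: mbool_dec_comp => //; meas.
    have mB : mbool (fun z => dec3 (tadd (enc3 w3) z) != w3) by apply: mbool_dec_comp => //; meas.
    (* If [X2] is decoded correctly, subtracting it leaves exactly [X3 + Z3], so an error must come
       from one of the two stages. *)
    apply: (@le_trans _ _ (pr (fun z => (D3 (tadd (tadd (tscale (a2 * v) (enc2' w2)) (tscale 1 (enc3 w3))) z) != w2)
       || (dec3 (tadd (enc3 w3) z) != w3)))).
      apply: le_pr.
      - by apply: mbool_dec_comp => //; meas.
      - exact: mboolU.
      - move=> z /=.
        have -> : tadd (tadd (enc3 w3) (tscale a2 (enc2 w2))) z =
          tadd (tadd (tscale (a2 * v) (enc2' w2)) (tscale 1 (enc3 w3))) z by tup; ring.
        set y := tadd (tadd (tscale _ _) _) z.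
        rewrite /dec3'; case: (D3 y =P w2) => [->|] //=.
        suff -> : tadd y (tscale (-1) (tscale a2 (enc2 w2))) = tadd (enc3 w3) z by [].
        by rewrite /y; tup; ring.
    apply: le_trans (prU mA mB) _; rewrite lerD2l.
    by apply: le_trans (er3 w3) _; clear aD2 aD3; lra.
  apply: (@le_trans _ _ (\sum_(w2 < m2.+1) (pr (fun z => D3 (tadd (tadd (tscale (a2 * v) (enc2' w2)) (tscale 1 (enc3 w3))) z) != w2) + 13 * th ^+ n))).
    by apply: ler_sum => w2 _; exact: e.
  rewrite big_split /= sumr_const card_ord -[_ *+ m2.+1]mulr_natl.
  clear aD2 aD3; lra.
Qed.

End z_channel_code.

(** * From code constructions to achievable rates *)

Section rates.
Variable R : realType.

(** Fills in the short lengths: achievability asks for an admissible code of the right size at every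
    [n], but bounds the error only for large [n]. *)
Lemma exists_code (n : nat) (P1 P2 P3 r1 r2 r3 : R) : 0 <= P1 -> 0 <= P2 -> 0 <= P3 ->
  exists m1 m2 m3 (c : Defs.code R n m1.+1 m2.+1 m3.+1), admissible P1 P2 P3 c /\
  [/\ 2 `^ (n%:R * r1) <= m1.+1%:R, 2 `^ (n%:R * r2) <= m2.+1%:R & 2 `^ (n%:R * r3) <= m3.+1%:R].
Proof.
move=> P10 P20 P30; pose m (r : R) := Num.truncn (2 `^ (n%:R * r) : R).
have hm r : 2 `^ (n%:R * r) <= (m r).+1%:R by apply: ltW; exact: truncnS_gt.
pose o := [tuple (0:R) | _ < n].
have po P : 0 <= P -> power_ok P o.
  move=> P0; rewrite /power_ok big1 ?mulr_ge0 // => i _.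
  by rewrite tnth_mktuple expr0n.
have mc k (i : 'I_k.+1) : measurable ((fun _ : n.-tuple R => ord0 : 'I_k.+1) @^-1` [set i]).
  have [->|i0] := eqVneq i ord0.
    by rewrite (_ : _ @^-1` _ = setT) //; apply/seteqP; split.
  rewrite (_ : _ @^-1` _ = set0) //; apply/seteqP; split => // x /= h.
  by rewrite h eqxx in i0.
exists (m r1), (m r2), (m r3), (Code (fun _ => o) (fun _ => o) (fun _ => o)
  (fun _ => ord0) (fun _ => ord0) (fun _ => ord0)); split.
  by split; split => // w; exact: po.
by split; exact: hm.
Qed.

Lemma achievable_rates (a1 a2 P1 P2 P3 r1 r2 r3 : R) :
  0 < P1 -> 0 < P2 -> 0 < P3 -> 0 < a2 -> 1 + P3 <= a2 ^+ 2 * (1 + a1 ^+ 2 * P1) ->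
  0 <= r1 -> 0 <= r2 -> 0 <= r3 ->
  r1 * ln 2 < ln (1 + P1) / 2 -> r2 * ln 2 < ln (1 + P2 / (1 + a1 ^+ 2 * P1)) / 2 ->
  r3 * ln 2 < ln (1 + P3) / 2 ->
  achievable a1 a2 P1 P2 P3 r1 r2 r3.
Proof.
move=> P10 P20 P30 a20 a2V r10 r20 r30 c1 c2 c3; split => //.
have [th [th0 th1 hth]] := zic_code P10 P20 P30 a20 a2V r10 r20 r30 c1 c2 c3.
(* Sizes and code are packed into one dependent pair so that a single choice for each [n] yields
   both. *)
have ex n : exists p : {m : nat * nat * nat & Defs.code R n m.1.1.+1 m.1.2.+1 m.2.+1},
  [/\ admissible P1 P2 P3 (projT2 p),
      [/\ 2 `^ (n%:R * r1) <= (projT1 p).1.1.+1%:R, 2 `^ (n%:R * r2) <= (projT1 p).1.2.+1%:R &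
          2 `^ (n%:R * r3) <= (projT1 p).2.+1%:R] &
      13 * th ^+ n <= 1 -> (perr a1 a2 (projT2 p) <= (52 * th ^+ n)%:E)%E].
  have [h|h] := leP (13 * th ^+ n) 1.
    have [m1 [m2 [m3 [c [ad rt pe]]]]] := hth n h.
    by exists (existT _ (m1, m2, m3) c).
  have [m1 [m2 [m3 [c [ad rt]]]]] := @exists_code n P1 P2 P3 r1 r2 r3 (ltW P10) (ltW P20) (ltW P30).
  by exists (existT _ (m1, m2, m3) c).
pose p n := projT1 (cid (ex n)).
have hp n := projT2 (cid (ex n)).
exists (fun n => (projT1 (p n)).1.1.+1), (fun n => (projT1 (p n)).1.2.+1),
  (fun n => (projT1 (p n)).2.+1), (fun n => projT2 (p n)); split.
- by move=> n; case: (hp n).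
- by move=> n; case: (hp n).
move=> e e0.
have th_small (d : R) : 0 < d -> exists N, forall n, (N <= n)%N -> th ^+ n <= d.
  move=> d0; have := @cvg_expr R th; rewrite ger0_norm ?(ltW th0) // => /(_ th1).
  move=> /cvgr0Pnorm_le /(_ d d0) [N _ hN]; exists N => n Nn.
  by have := hN n Nn; rewrite /= ger0_norm // exprn_ge0 // ltW.
(* The two bounds ensure [52 * th ^+ n <= e] and the condition [13 * th ^+ n <= 1] of the
   construction. *)
have d0 : 0 < Num.min (e / 52) 13^-1.
  by rewrite lt_min; apply/andP; split; [apply: divr_gt0 | rewrite invr_gt0].
have [N hN] := th_small _ d0; exists N => n Nn.
have := hN n Nn; rewrite le_min => /andP[h1 h2].
have [_ _ pe] := hp n.
apply: le_trans (pe _) _.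
  by rewrite -ler_pdivlMl // mulr1.
by rewrite lee_fin -ler_pdivlMl // mulrC.
Qed.

Lemma rate_below (C d : R) : 0 < C -> 0 < d -> exists r, [/\ 0 <= r, r < C & C - d <= r].
Proof.
move=> C0 d0; exists (Num.max 0 (C - d)); split; rewrite ?le_max ?gt_max ?lexx ?orbT //.
by rewrite C0 gtrBl.
Qed.

End rates.

Unset Implicit Arguments.

Theorem theorem3 (R : realType) (a1 a2 P1 P2 P3 : R) :
  0 < P1 -> 0 < P2 -> 0 < P3 ->
  0 <= a1 -> 0 <= a2 ->
  a1 < 1 ->
  Num.sqrt ((1 + P3) / (1 + a1 ^+ 2 * P1)) <= a2 ->
  a2 < Num.sqrt (1 + P3) ->
  is_sum_capacity a1 a2 P1 P2 P3
    (Cfun P1 + Cfun (P2 / (1 + a1 ^+ 2 * P1)) + Cfun P3).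
Proof.
move=> P10 P20 P30 a10 a20 a11 a2l _.
have V0 : 0 < 1 + a1 ^+ 2 * P1 by rewrite ltr_pwDl // mulr_ge0 ?sqr_ge0 // ltW.
have a12 : a1 ^+ 2 < 1 by rewrite expr_lt1.
split=> [r1 r2 r3|e e0]; first exact: achievable_le.
have X0 : 0 < (1 + P3) / (1 + a1 ^+ 2 * P1) by rewrite divr_gt0 // ltr_pwDl // ltW.
have a2p : 0 < a2 by apply: lt_le_trans a2l; rewrite sqrtr_gt0.
(* The squared form of the lower bound on [a2]. *)
have a2V : 1 + P3 <= a2 ^+ 2 * (1 + a1 ^+ 2 * P1).
  rewrite -ler_pdivrMr // -[leLHS]sqr_sqrtr; last exact: ltW.
  by rewrite lerXn2r ?nnegrE ?sqrtr_ge0.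
have ln20 : 0 < ln 2 :> R by rewrite ln_gt0 // ltr1n.
have C0 (P : R) : 0 < P -> 0 < Cfun P.
  by move=> P0; rewrite /Cfun /log2 mulr_gt0 ?divr_gt0 ?invr_gt0 // ln_gt0 // ltrDl.
have below (P r : R) : r < Cfun P -> r * ln 2 < ln (1 + P) / 2.
  by rewrite /Cfun /log2 mulrA ltr_pdivlMr // mulrC [2^-1 * _]mulrC.
(* Each rate loses at most [e / 4], so the sum loses at most [3 e / 4], strictly less than [e]. *)
have e4 : 0 < e / 4 by rewrite divr_gt0.
have [r1 [r10 r1C l1]] := rate_below (C0 P1 P10) e4.
have [r2 [r20 r2C l2]] := rate_below (C0 _ (divr_gt0 P20 V0)) e4.
have [r3 [r30 r3C l3]] := rate_below (C0 P3 P30) e4.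
exists r1, r2, r3; split; last lra.
by apply: achievable_rates => //; exact: below.
Qed.
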